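(* Let $\mathbf M=(S,\mathcal I)$ be a matroid given by an independence oracle and $G=(S,E)$ a graph such that $(\mathbf M,G)$ is tractable. Then all maximum-cardinality matchings of $(\mathbf M,G)$ can be enumerated with delay polynomial in $n+Q$ and space polynomial in $n+\hat Q$, where $n=|S|$.
   Context: Oracle calls take $Q$ time and $\hat Q$ space. For $F\subseteq E$ let $V(F)=\bigcup_{e\in F}e$. A matching of $(\mathbf M,G)$ is a matching $M$ of $G$ with $V(M)\in\mathcal I$. Restriction $\mathbf M|X$: independent sets of $\mathcal I$ inside $X$; deletion $\mathbf M\setminus X=\mathbf M|(S\setminus X)$; contraction $\mathbf M/X$: matroid on $S\setminus X$ where $Y$ is independent iff $\mathbf M|X$ has a base $B$ with $Y\cup B\in\mathcal I$. $(\mathbf M,G)$ is tractable if for all $X\subseteq S$, spanning subgraphs $H$ of $G[X]$ and $H'$ of $G[S\setminus X]$, maximum matchings of $(\mathbf M|X,H)$, $(\mathbf M\setminus X,H')$, $(\mathbf M/X,H')$ can be found in time polynomial in $n+Q$ and space polynomial in $n+\hat Q$. *)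

(* Defs.v *)
From HB Require Import structures.
From mathcomp Require Import all_boot all_order all_algebra.

Set Implicit Arguments.
Unset Strict Implicit.
Unset Printing Implicit Defensive.

(* Plain MathComp. *)

(** * Matroids, minors, graphs and matchings *)

Record setsys (T : finType) := SetSys {
  ground : {set T};
  indep : {set {set T}}
}.

Definition is_matroid (T : finType) (M : setsys T) : Prop :=
  [/\ forall A : {set T}, A \in indep M -> A \subset ground M,
      set0 \in indep M,
      forall A B : {set T}, B \in indep M -> A \subset B -> A \in indep M
    & forall A B : {set T}, A \in indep M -> B \in indep M -> #|A| < #|B| ->
        exists2 x, x \in B :\: A & x |: A \in indep M].

Definition is_base (T : finType) (M : setsys T) (B : {set T}) : bool :=
  maxset (fun A : {set T} => A \in indep M) B.

Definition restriction (T : finType) (M : setsys T) (X : {set T}) : setsys T :=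
  SetSys (ground M :&: X) [set Y in indep M | Y \subset X].

Definition deletion (T : finType) (M : setsys T) (X : {set T}) : setsys T :=
  restriction M (ground M :\: X).

Definition contraction (T : finType) (M : setsys T) (X : {set T}) : setsys T :=
  SetSys (ground M :\: X)
    [set Y : {set T} | (Y \subset ground M :\: X) &&
       [exists B : {set T}, is_base (restriction M X) B &&
                            (Y :|: B \in indep M)]].

(* A finite simple graph with vertex set [V] is given by its edge set. *)
Definition is_graph (T : finType) (V : {set T}) (E : {set {set T}}) : Prop :=
  forall e : {set T}, e \in E -> e \subset V /\ #|e| = 2.

Definition induced (T : finType) (E : {set {set T}}) (V : {set T}) :
    {set {set T}} :=
  [set e : {set T} in E | e \subset V].

(* V(F) is [cover F]. *)
Definition matchings (T : finType) (M : setsys T) (E : {set {set T}}) :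
    {set {set {set T}}} :=
  [set F : {set {set T}} | [&& F \subset E, trivIset F & cover F \in indep M]].

Definition maximum_matchings (T : finType) (M : setsys T)
    (E : {set {set T}}) : {set {set {set T}}} :=
  [set F in matchings M E | [forall F' in matchings M E, #|F'| <= #|F|]].

(** * Oracle programs

    Structured programs over finitely many stacks of bits.  Two stacks make
    one tape, so this is the multitape oracle Turing machine up to a constant
    factor in time and space.  Stack [x] is the [x]-th entry of the store;
    stacks beyond the end of the list are empty. *)

Definition word := seq bool.
Definition store := seq word.

Definition stack (s : store) (x : nat) : word := nth [::] s x.
Definition update (s : store) (x : nat) (w : word) : store :=
  set_nth [::] s x w.
Definition store_size (s : store) : nat := sumn (map size s).

Inductive cmd :=
| Skip
| Push of nat & bool
| Pop of nat                          (* no effect on an empty stack *)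
| Seq of cmd & cmd
| Case of nat & cmd & cmd & cmd       (* stack empty / top false / top true *)
| While of nat & cmd                  (* loop while the stack is nonempty *)
| Query of nat & nat                  (* [Query x y]: push the oracle's answer
                                         to the word on [x] onto [y] *)
| Emit of nat.                        (* append the word on [x] to the
                                         write-only output *)

Record oracle := Oracle {
  answer : word -> bool;
  call_time : nat;
  call_space : nat
}.

(* [Step t m]: the next [t] time units are spent using [m] units of space. *)
Inductive event :=
| Step of nat & nat
| Out of word.

(* [exec o c s tr s']: started on [s], the program [c] halts on [s'] and
   performs the events [tr].  An oracle call costs its issuing step plus
   [call_time o], and occupies [call_space o] on top of the stacks. *)
Inductive exec (o : oracle) : cmd -> store -> seq event -> store -> Prop :=
| ExecSkip s : exec o Skip s [::] s
| ExecPush x b s (s' := update s x (b :: stack s x)) :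
    exec o (Push x b) s [:: Step 1 (store_size s')] s'
| ExecPop x s :
    exec o (Pop x) s [:: Step 1 (store_size s)]
      (update s x (behead (stack s x)))
| ExecSeq c1 c2 s s1 s2 tr1 tr2 :
    exec o c1 s tr1 s1 -> exec o c2 s1 tr2 s2 ->
    exec o (Seq c1 c2) s (tr1 ++ tr2) s2
| ExecCase x ce cf ct s s' tr :
    exec o (match stack s x with
            | [::] => ce
            | false :: _ => cf
            | true :: _ => ct
            end) s tr s' ->
    exec o (Case x ce cf ct) s (Step 1 (store_size s) :: tr) s'
| ExecWhileStop x c s :
    stack s x = [::] ->
    exec o (While x c) s [:: Step 1 (store_size s)] s
| ExecWhileLoop x c s s1 s2 tr1 tr2 :
    stack s x <> [::] -> exec o c s tr1 s1 -> exec o (While x c) s1 tr2 s2 ->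
    exec o (While x c) s (Step 1 (store_size s) :: tr1 ++ tr2) s2
| ExecQuery x y s (s' := update s y (answer o (stack s x) :: stack s y)) :
    exec o (Query x y) s
      [:: Step (call_time o).+1 (store_size s' + call_space o)] s'
| ExecEmit x s :
    exec o (Emit x) s
      [:: Step (size (stack s x)).+1 (store_size s); Out (stack s x)] s.

Definition time (tr : seq event) : nat :=
  \sum_(e <- tr) (if e is Step t _ then t else 0).

Definition space (tr : seq event) : nat :=
  \max_(e <- tr) (if e is Step _ m then m else 0).

Definition outputs (tr : seq event) : seq word :=
  pmap (fun e => if e is Out w then Some w else None) tr.

(* [delays 0 tr] lists the time up to the first output, the times between
   consecutive outputs, and the time from the last output to termination; [t]
   is the time already elapsed since the last output. *)
Fixpoint delays (t : nat) (tr : seq event) : seq nat :=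
  match tr with
  | [::] => [:: t]
  | Step u _ :: tr' => delays (t + u) tr'
  | Out _ :: tr' => t :: delays 0 tr'
  end.

(** * Problem instances and their encoding *)

Record instance := Instance {
  elements : finType;
  matroid : setsys elements;
  edges : {set {set elements}};
  oracle_time : nat;
  oracle_space : nat;
  ground_matroid : ground matroid = [set: elements];
  matroidP : is_matroid matroid;
  edgesP : is_graph [set: elements] edges
}.

Definition num_elements (I : instance) : nat := #|elements I|.

(* Vertex sets and edge sets are encoded by their characteristic vectors with
   respect to [enum (elements I)] and [enum (edges I)]. *)
Definition char_word (A : eqType) (s : seq A) (P : pred A) : word :=
  [seq P x | x <- s].

Definition encode_vertices (I : instance) (X : {set elements I}) : word :=
  char_word (enum (elements I)) (fun x => x \in X).

Definition encode_edges (I : instance) (F : {set {set elements I}}) : word :=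
  char_word (enum (edges I)) (fun e => e \in F).

(* The incidence matrix of the graph, one row per edge. *)
Definition encode_graph (I : instance) : word :=
  flatten [seq @encode_vertices I e | e <- enum (edges I)].

(* Missing bits count as [false]; bits beyond the [n]-th are ignored. *)
Definition decode_vertices (I : instance) (w : word) : {set elements I} :=
  [set x | nth false w (enum_rank x)].

Definition independence_oracle (I : instance) : oracle :=
  Oracle (fun w => decode_vertices I w \in indep (matroid I))
         (oracle_time I) (oracle_space I).

Definition encode_instance (I : instance) : store :=
  [:: nseq (num_elements I) true; encode_graph I].

(** * Tractability and enumeration

    Polynomial bounds are asymptotic notions, so both properties concern a
    class [C] of instances: one program and one pair of polynomials serve all
    members of [C]. *)

(* The answer is the content of stack 0 at termination; what the program may
   have emitted on the way is disregarded. *)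
Definition maximum_matching_findable (C : instance -> Prop)
    (minor : forall T : finType, setsys T -> {set T} -> setsys T) : Prop :=
  exists (c : cmd) (p q : {poly nat}),
  forall I : instance, C I ->
  forall (X : {set elements I}) (H : {set {set elements I}}),
  H \subset induced (edges I) (ground (minor _ (matroid I) X)) ->
  exists (tr : seq event) (s : store) (F : {set {set elements I}}),
    [/\ exec (independence_oracle I) c
          (encode_instance I ++ [:: encode_vertices X; encode_edges H]) tr s,
        F \in maximum_matchings (minor _ (matroid I) X) H,
        stack s 0 = encode_edges F,
        time tr <= horner p (num_elements I + oracle_time I)
      & space tr <= horner q (num_elements I + oracle_space I)].

Definition tractable (C : instance -> Prop) : Prop :=
  [/\ maximum_matching_findable C restriction,
      maximum_matching_findable C deletion
    & maximum_matching_findable C contraction].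

(* [perm_eq] makes every maximum matching be output exactly once. *)
Definition maximum_matchings_enumerable (C : instance -> Prop) : Prop :=
  exists (c : cmd) (p q : {poly nat}),
  forall I : instance, C I ->
  exists (tr : seq event) (s : store),
    [/\ exec (independence_oracle I) c (encode_instance I) tr s,
        perm_eq (outputs tr)
          [seq encode_edges F
             | F <- enum (maximum_matchings (matroid I) (edges I))],
        all (fun d => d <= horner p (num_elements I + oracle_time I)) (delays 0 tr)
      & space tr <= horner q (num_elements I + oracle_space I)].

(* Main.v *)
(** Flashlight search through the decisions "edge taken or not", in the order of
    the encoding.  Let [A] be the set of edges taken so far, and let [H] be the
    set of undecided edges disjoint from V(A).  If [A] extends to a maximum
    matching then V(A) is independent, so the matchings of (M / V(A), H) are
    exactly the ways to extend [A]; hence, for a maximum matching [F'] of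
    (M / V(A), H), the set [A :|: F'] is itself a maximum matching.  The converse
    is obvious, so one call to the subroutine for contractions decides whether a
    branch contains a solution.  A live branch thus has a live child, and
    consecutive outputs are separated by O(|E|) calls. *)

From mathcomp Require Import all_boot all_order all_algebra.
From mathcomp Require Import zify.
Require Import Defs.

Set Implicit Arguments.
Unset Strict Implicit.
Unset Printing Implicit Defensive.

(** Three obstacles shape the proof. (1) A prefix [A] need not be a matching, and V(A) may be
    dependent. The contraction is still defined then, but its matchings say nothing about [A]. So
    the answer F' is never trusted: the program tests on [A :|: F'] itself that the vertex set is
    independent (one query), that the edges are disjoint (by counting vertices) and that the size is
    the matching number. That number comes from the same test with no decision made, since
    contracting the empty set changes nothing. (2) Time may depend on Q but space may not, and the
    subroutine leaves garbage of unknown content. The garbage is bounded twice, by the time and by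
    the space of the call: the first bound pays for the time of erasing it, the second for the room
    it occupies. (3) Programs have no recursion, so the search is a single loop whose whole state is
    the current prefix; leaving a subtree means passing to the next prefix in lexicographic order,
    however many levels up. Delays are then counted in iterations of this loop. *)

(** * Programs, stores and traces *)

(* Equality up to trailing empty stacks. *)
Definition equiv (s t : store) : Prop := forall x, stack s x = stack t x.

Lemma equiv_trans s t u : equiv s t -> equiv t u -> equiv s u.
Proof. by move=> st tu x; rewrite st. Qed.

Lemma stack_update s x w y :
  stack (update s x w) y = if y == x then w else stack s y.
Proof. exact: nth_set_nth. Qed.

Lemma equiv_update s t x w : equiv s t -> equiv (update s x w) (update t x w).
Proof. by move=> st y; rewrite !stack_update st. Qed.

Lemma store_sizeE k s : size s <= k ->
  store_size s = \sum_(0 <= i < k) size (stack s i).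
Proof.
rewrite /store_size; elim: s k => [|w s IHs] [|k] //= hk.
- by rewrite big_geq.
- by rewrite big1_seq // => i _; rewrite /stack nth_nil.
- by rewrite big_nat_recl // (IHs k).
Qed.

Lemma store_size_equiv s t : equiv s t -> store_size s = store_size t.
Proof.
move=> st; rewrite (@store_sizeE (maxn (size s) (size t)) s) ?leq_maxl //.
rewrite (@store_sizeE (maxn (size s) (size t)) t) ?leq_maxr //.
by apply: eq_bigr => i _; rewrite st.
Qed.

Lemma store_size_update s x w :
  store_size (update s x w) + size (stack s x) = store_size s + size w.
Proof.
rewrite /store_size /update /stack.
elim: s x => [|v s IHs] [|x] //=; first by lia.
- by elim: x => [|x IHx] /=; lia.
- by lia.
- by have := IHs x; lia.
Qed.

Lemma store_size_cat s t : store_size (s ++ t) = store_size s + store_size t.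
Proof. by rewrite /store_size map_cat sumn_cat. Qed.

Lemma time_cons e tr :
  time (e :: tr) = (if e is Step t _ then t else 0) + time tr.
Proof. exact: big_cons. Qed.

Lemma time_nil : time [::] = 0.
Proof. exact: big_nil. Qed.

Lemma time_cat tr1 tr2 : time (tr1 ++ tr2) = time tr1 + time tr2.
Proof. exact: big_cat. Qed.

Lemma space_cons e tr :
  space (e :: tr) = maxn (if e is Step _ m then m else 0) (space tr).
Proof. exact: big_cons. Qed.

Lemma space_nil : space [::] = 0.
Proof. exact: big_nil. Qed.

Lemma space_cat tr1 tr2 : space (tr1 ++ tr2) = maxn (space tr1) (space tr2).
Proof. exact: big_cat. Qed.

Lemma outputs_cat tr1 tr2 : outputs (tr1 ++ tr2) = outputs tr1 ++ outputs tr2.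
Proof. exact: pmap_cat. Qed.

Definition costE :=
  (time_cons, time_nil, time_cat, space_cons, space_nil, space_cat).

(** Writing to a stack beyond the end pads the store with empty stacks, so final stores are known
    only up to [equiv]. The trace carries over unchanged because [equiv] stores have the same
    size. *)
Lemma exec_equiv o c s tr s' : exec o c s tr s' ->
  forall t, equiv s t -> exists2 t', equiv s' t' & exec o c t tr t'.
Proof.
elim=> {c s tr s'}.
- by move=> s t st; exists t => //; apply: ExecSkip.
- move=> x b s s' t st.
  have st' := equiv_update x (b :: stack s x) st.
  exists (update t x (b :: stack s x)) => //.
  by rewrite (store_size_equiv st') st; apply: ExecPush.
- move=> x s t st; exists (update t x (behead (stack s x))).
    exact: equiv_update.
  by rewrite st (store_size_equiv st); apply: ExecPop.
- move=> c1 c2 s s1 s2 tr1 tr2 _ IH1 _ IH2 t /IH1[t1 /IH2[t2 ? ?] ?].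
  by exists t2 => //; apply: ExecSeq; eassumption.
- move=> x ce cf ct s s' tr _ IH t st; have [t' st' e] := IH t st.
  by exists t' => //; rewrite (store_size_equiv st); apply: ExecCase; rewrite -st.
- move=> x c s s0 t st; exists t => //.
  by rewrite (store_size_equiv st); apply: ExecWhileStop; rewrite -st.
- move=> x c s s1 s2 tr1 tr2 n0 _ IH1 _ IH2 t st.
  have [t1 /IH2[t2 ? ?] ?] := IH1 t st.
  exists t2 => //; rewrite (store_size_equiv st).
  by apply: ExecWhileLoop; rewrite -?st; eassumption.
- move=> x y s s' t st.
  have st' := equiv_update y (answer o (stack s x) :: stack s y) st.
  exists (update t y (answer o (stack s x) :: stack s y)) => //.
  by rewrite (store_size_equiv st') !st; apply: ExecQuery.
- move=> x s t st; exists t => //.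
  by rewrite st (store_size_equiv st); apply: ExecEmit.
Qed.

(* Emissions of the embedded program are suppressed. *)
Fixpoint embed (v : nat) (c : cmd) : cmd :=
  match c with
  | Skip => Skip
  | Push x b => Push (v + x) b
  | Pop x => Pop (v + x)
  | Seq c1 c2 => Seq (embed v c1) (embed v c2)
  | Case x ce cf ct => Case (v + x) (embed v ce) (embed v cf) (embed v ct)
  | While x c => While (v + x) (embed v c)
  | Query x y => Query (v + x) (v + y)
  | Emit _ => Skip
  end.

Lemma stack_shift (p s : store) x : stack (p ++ s) (size p + x) = stack s x.
Proof. by rewrite /stack nth_cat ltnNge leq_addr /= addKn. Qed.

Lemma update_shift (p s : store) x w :
  update (p ++ s) (size p + x) w = p ++ update s x w.
Proof. by rewrite /update; elim: p => //= v p ->. Qed.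

(** The stacks of [p] form a frame: shifted indices never reach them, so they only add their
    constant size to the space. Suppressing emissions can only lower both costs. *)
Lemma exec_embed (p : store) o c s tr s' : exec o c s tr s' ->
  exists tr', [/\ exec o (embed (size p) c) (p ++ s) tr' (p ++ s'),
    outputs tr' = [::], time tr' <= time tr
    & space tr' <= store_size p + space tr].
Proof.
elim=> {c s tr s'} /=.
- by move=> s; exists [::]; split; rewrite ?costE //; apply: ExecSkip.
- move=> x b s; set s' := update _ _ _.
  exists [:: Step 1 (store_size (p ++ s'))].
  split; rewrite ?costE ?store_size_cat ?maxn0 //.
  by rewrite -store_size_cat /s' -update_shift -(stack_shift p); apply: ExecPush.
- move=> x s; exists [:: Step 1 (store_size (p ++ s))].
  split; rewrite ?costE ?store_size_cat ?maxn0 //.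
  by rewrite -store_size_cat -update_shift -(stack_shift p); apply: ExecPop.
- move=> c1 c2 s s1 s2 tr1 tr2 _ [t1 [e1 o1 l1 m1]] _ [t2 [e2 o2 l2 m2]].
  exists (t1 ++ t2); split; rewrite ?costE ?outputs_cat ?o1 ?o2 //; try by lia.
  exact: ExecSeq e1 e2.
- move=> x ce cf ct s s' tr _ [t [e ot lt mt]].
  exists (Step 1 (store_size (p ++ s)) :: t).
  split; rewrite ?costE ?store_size_cat //=; try by lia.
  rewrite -store_size_cat; apply: ExecCase; rewrite stack_shift.
  by move: e; case: (stack s x) => [|[] ?].
- move=> x c s s0; exists [:: Step 1 (store_size (p ++ s))].
  split; rewrite ?costE ?store_size_cat ?maxn0 //.
  by rewrite -store_size_cat; apply: ExecWhileStop; rewrite stack_shift.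
- move=> x c s s1 s2 tr1 tr2 n0 _ [t1 [e1 o1 l1 m1]] _ [t2 [e2 o2 l2 m2]].
  exists (Step 1 (store_size (p ++ s)) :: t1 ++ t2).
  split; rewrite ?costE ?store_size_cat /= ?outputs_cat ?o1 ?o2 //; try by lia.
  by rewrite -store_size_cat; apply: ExecWhileLoop e1 e2; rewrite stack_shift.
- move=> x y s; set s' := update _ _ _.
  exists [:: Step (call_time o).+1 (store_size (p ++ s') + call_space o)].
  split; rewrite ?costE ?store_size_cat ?maxn0 ?addnA //.
  rewrite -store_size_cat /s' -update_shift -(stack_shift p s x) -(stack_shift p s y).
  exact: ExecQuery.
- by move=> x s; exists [::]; split; rewrite ?costE //; apply: ExecSkip.
Qed.

(** Only stacks that [c] may modify count; a stack that is merely read needs no cleaning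
    afterwards. *)
Fixpoint width (c : cmd) : nat :=
  match c with
  | Skip | Emit _ => 0
  | Push x _ | Pop x | Query _ x => x.+1
  | Seq c1 c2 => maxn (width c1) (width c2)
  | Case _ ce cf ct => maxn (width ce) (maxn (width cf) (width ct))
  | While _ c => width c
  end.

Lemma exec_width o c s tr s' : exec o c s tr s' ->
  forall y, width c <= y -> stack s' y = stack s y.
Proof.
elim=> {c s tr s'} //=.
- by move=> x b s y xy; rewrite stack_update gtn_eqF.
- by move=> x s y xy; rewrite stack_update gtn_eqF.
- move=> c1 c2 s s1 s2 _ _ _ IH1 _ IH2 y.
  by rewrite geq_max => /andP[/IH1 <- /IH2].
- move=> x ce cf ct s s' tr _ IH y; rewrite !geq_max => /and3P[? ? ?].
  by apply: IH; case: (stack s x) => [|[] ?].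
- by move=> x c s s1 s2 _ _ _ _ IH1 _ IH2 y hy; rewrite IH2 ?IH1.
- by move=> x x' s y xy; rewrite stack_update gtn_eqF.
Qed.

(** A time unit writes at most one bit, and every step records at least the size of the store it
    leaves. The first bound limits the time for erasing what the subroutine leaves behind, the
    second the space meanwhile. *)
Lemma exec_size o c s tr s' : exec o c s tr s' ->
  store_size s' <= store_size s + time tr
  /\ store_size s' <= maxn (store_size s) (space tr).
Proof.
elim=> {c s tr s'} //=.
- by move=> s; rewrite !costE; lia.
- move=> x b s; rewrite !costE.
  by have := store_size_update s x (b :: stack s x); rewrite /=; lia.
- move=> x s; rewrite !costE.
  have := store_size_update s x (behead (stack s x)).
  by rewrite size_behead /=; lia.
- by move=> c1 c2 s s1 s2 tr1 tr2 _ [? ?] _ [? ?]; rewrite !costE; lia.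
- by move=> x ce cf ct s s' tr _ [? ?]; rewrite !costE; lia.
- by move=> *; rewrite !costE; lia.
- by move=> x c s s1 s2 tr1 tr2 _ _ [? ?] _ [? ?]; rewrite !costE; lia.
- move=> x y s; rewrite !costE.
  by have := store_size_update s y (answer o (stack s x) :: stack s y); rewrite /=; lia.
- by move=> *; rewrite !costE; lia.
Qed.

(** * Straight-line code and loops over a stack *)

(* Every instruction costs at most one oracle call and pushes at most one bit,
   so a single number [t] bounds both the time and the growth of the store. *)
Definition run (o : oracle) (c : cmd) (s s' : store) (t : nat) : Prop :=
  exists tr s0, [/\ exec o c s tr s0, equiv s0 s', outputs tr = [::],
    time tr <= t * (call_time o).+1
    & space tr <= store_size s + t + call_space o /\
      store_size s' <= store_size s + t].

Lemma run_weak o c s s' t t' : run o c s s' t -> t <= t' -> run o c s s' t'.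
Proof.
case=> tr [s0 [e q ot lt [mt ms]]] tt'; exists tr, s0; split=> //; last by lia.
by apply: leq_trans lt _; rewrite leq_mul2r tt' orbT.
Qed.

Lemma run_to o c s s1 s' t : run o c s s1 t -> equiv s1 s' -> run o c s s' t.
Proof.
case=> tr [s0 [e q ot lt [mt ms]]] st; exists tr, s0.
by split=> //; [exact: equiv_trans st | rewrite -(store_size_equiv st)].
Qed.

Lemma run_skip o s t : run o Skip s s t.
Proof.
by exists [::], s; split; rewrite ?costE //; [apply: ExecSkip | lia].
Qed.

Lemma run_push o x b s t : 0 < t ->
  run o (Push x b) s (update s x (b :: stack s x)) t.
Proof.
move=> t0; exists [:: Step 1 (store_size (update s x (b :: stack s x)))].
exists (update s x (b :: stack s x)).
have := store_size_update s x (b :: stack s x).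
split; rewrite ?costE //=; [exact: ExecPush | nia | move: H; rewrite /=; lia].
Qed.

Lemma run_pop o x s t : 0 < t ->
  run o (Pop x) s (update s x (behead (stack s x))) t.
Proof.
move=> t0; exists [:: Step 1 (store_size s)].
exists (update s x (behead (stack s x))).
have := store_size_update s x (behead (stack s x)); rewrite size_behead => sz.
split; rewrite ?costE //=; [exact: ExecPop | nia | lia].
Qed.

Lemma run_query o x y s t : 0 < t ->
  run o (Query x y) s (update s y (answer o (stack s x) :: stack s y)) t.
Proof.
move=> t0; set s' := update _ _ _.
exists [:: Step (call_time o).+1 (store_size s' + call_space o)], s'.
have := store_size_update s y (answer o (stack s x) :: stack s y).
rewrite -/s' /= => sz.
split; rewrite ?costE //=; [exact: ExecQuery | nia | lia].
Qed.

Lemma run_seq o c1 c2 s s1 s2 t1 t2 t : run o c1 s s1 t1 -> run o c2 s1 s2 t2 ->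
  t1 + t2 <= t -> run o (Seq c1 c2) s s2 t.
Proof.
case=> tr1 [s1' [e1 q1 o1 l1 [m1 z1]]] [tr2 [s2' [e2 q2 o2 l2 [m2 z2]]]] tt.
have q1' : equiv s1 s1' by move=> x; rewrite q1.
have [s3 q3 e3] := exec_equiv e2 q1'.
exists (tr1 ++ tr2), s3; split.
- exact: ExecSeq e1 e3.
- by move=> x; rewrite -q3 q2.
- by rewrite outputs_cat o1 o2.
- rewrite time_cat; apply: leq_trans (leq_add l1 l2) _.
  by rewrite -mulnDl leq_mul2r tt orbT.
- by rewrite space_cat geq_max; split; [apply/andP; split|]; lia.
Qed.

Lemma run_case o x ce cf ct s s' t t' :
  run o (match stack s x with
         | [::] => ce | false :: _ => cf | true :: _ => ct end) s s' t ->
  t < t' -> run o (Case x ce cf ct) s s' t'.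
Proof.
case=> tr [s0 [e q ot lt [mt zt]]] tt.
exists (Step 1 (store_size s) :: tr), s0; split=> //.
- exact: ExecCase.
- rewrite time_cons; nia.
- by rewrite space_cons; lia.
Qed.

Lemma run_stop o x c s t : stack s x = [::] -> 0 < t -> run o (While x c) s s t.
Proof.
move=> x0 t0; exists [:: Step 1 (store_size s)], s.
by split; rewrite ?costE //; [apply: ExecWhileStop | nia | lia].
Qed.

Lemma run_loop o x c s s1 s2 t1 t2 t : stack s x <> [::] ->
  run o c s s1 t1 -> run o (While x c) s1 s2 t2 -> t1 + t2 < t ->
  run o (While x c) s s2 t.
Proof.
move=> x0; case=> tr1 [s1' [e1 q1 o1 l1 [m1 z1]]].
case=> [tr2 [s2' [e2 q2 o2 l2 [m2 z2]]]] tt.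
have q1' : equiv s1 s1' by move=> y; rewrite q1.
have [s3 q3 e3] := exec_equiv e2 q1'.
exists (Step 1 (store_size s) :: tr1 ++ tr2), s3; split.
- exact: ExecWhileLoop e1 e3.
- by move=> y; rewrite -q3 q2.
- by rewrite -(cat1s (Step _ _)) !outputs_cat o1 o2.
- rewrite !costE; nia.
- by rewrite !costE !geq_max; split; [apply/and3P; split|]; lia.
Qed.

Definition each (x : nat) (cf ct : cmd) : cmd :=
  While x (Seq (Case x Skip cf ct) (Pop x)).

Definition copy_bit (x y : nat) : cmd :=
  Case x Skip (Push y false) (Push y true).

Definition move (x y : nat) : cmd := each x (Push y false) (Push y true).

Definition clear (x : nat) : cmd := each x Skip Skip.

Lemma run_copy_bit o x y b w s : stack s x = b :: w ->
  run o (copy_bit x y) s (update s y (b :: stack s y)) 2.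
Proof.
move=> sx; apply: (@run_case _ _ _ _ _ _ _ 1) => //.
by rewrite sx; case: b sx => sx; apply: run_push.
Qed.

Lemma run_from o c s s1 s' t : run o c s s' t -> equiv s s1 -> run o c s1 s' t.
Proof.
case=> tr [s0 [e q ot lt [mt ms]]] st; have [s2 q2 e2] := exec_equiv e st.
exists tr, s2; rewrite -(store_size_equiv st).
by split=> // x; rewrite -q2 q.
Qed.

(** [S a w] is the store with [w] left on the loop stack and data [a] accumulated so far. The body
    runs with the current bit still on top; the loop test, the branching and the pop make up the
    [3]. *)
Lemma run_each (T : Type) (step : T -> bool -> T) (S : T -> word -> store)
    o x cf ct t :
  (forall a w, stack (S a w) x = w) ->
  (forall a b w, equiv (update (S a (b :: w)) x w) (S a w)) ->
  (forall a b w, run o (if b then ct else cf)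
     (S a (b :: w)) (S (step a b) (b :: w)) t) ->
  forall w a t', (t + 3) * size w < t' ->
    run o (each x cf ct) (S a w) (S (foldl step a w) [::]) t'.
Proof.
move=> Sx Su Sb; elim=> [|b w IHw] a t' /= lt; first by apply: run_stop => //; lia.
apply: (run_loop (t1 := t + 2) _ _ (IHw (step a b) _ (ltnSn _))).
- by rewrite Sx.
- apply: (run_seq (s1 := S (step a b) (b :: w)) (t1 := t.+1)).
  + by apply: (run_case (t := t)) => //; rewrite Sx; case: b (Sb a b w).
  + by apply: run_to (run_pop _ _ _ (ltn0Sn 0)) _; rewrite Sx; apply: Su.
  + by lia.
- by lia.
Qed.

Lemma foldl_cons (w v : word) : foldl (fun a b => b :: a) v w = catrev w v.
Proof. by elim: w v => //= b w IHw v; rewrite IHw. Qed.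

Lemma run_move o x y s t : x != y -> 4 * size (stack s x) < t ->
  run o (move x y) s
    (update (update s y (catrev (stack s x) (stack s y))) x [::]) t.
Proof.
move=> xy lt; rewrite -foldl_cons.
pose S a w := update (update s y a) x w.
apply: run_from (run_each (step := fun a b => b :: a) (S := S) (t := 1) _ _ _ _ lt) _.
- by move=> a w; rewrite stack_update eqxx.
- by move=> a b w z; rewrite !stack_update; case: eqP.
- move=> a b w; apply: run_to (_ : run o _ _ (update (S a (b :: w)) y (b :: a)) 1) _.
    have sy : a = stack (S a (b :: w)) y.
      by rewrite !stack_update eqxx eq_sym (negPf xy).
    by rewrite [b :: a](congr1 (cons b) sy); case: b {sy}; apply: run_push.
  move=> z; rewrite !stack_update; case: (z =P x) => [->|//].
    by rewrite (negPf xy).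
  by case: eqP.
- by move=> z; rewrite !stack_update; case: (z =P x) => [->|] //; case: eqP => [->|].
Qed.

Definition move_with (f : bool -> bool) (x y z : nat) : cmd :=
  each x (Seq (Push y false) (Push z (f false)))
         (Seq (Push y true) (Push z (f true))).

Lemma run_move_with o x y z (f : bool -> bool) s t :
  x != y -> x != z -> y != z -> 5 * size (stack s x) < t ->
  run o (move_with f x y z) s
    (update (update (update s y (catrev (stack s x) (stack s y)))
       z (catrev (map f (stack s x)) (stack s z))) x [::]) t.
Proof.
move=> xy xz yz lt.
pose step (a : word * word) b := (b :: a.1, f b :: a.2).
pose S (a : word * word) w := update (update (update s y a.1) z a.2) x w.
have foldE w a : foldl step a w = (catrev w a.1, catrev (map f w) a.2).
  by elim: w a => [|b w IHw] [a1 a2] //=; rewrite IHw.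
have := @run_each _ step S o x (Seq (Push y false) (Push z (f false)))
  (Seq (Push y true) (Push z (f true))) 2 _ _ _ (stack s x)
  (stack s y, stack s z) t lt.
rewrite foldE => /= rS; apply: run_from (rS _ _ _) _.
- by move=> a w; rewrite stack_update eqxx.
- by move=> a b w u; rewrite !stack_update; case: eqP.
- move=> [a1 a2] b w; pose s1 := update (S (a1, a2) (b :: w)) y (b :: a1).
  apply: run_to (_ : run o _ _ (update s1 z (f b :: a2)) 2) _.
    have sy : a1 = stack (S (a1, a2) (b :: w)) y.
      by rewrite !stack_update /= eqxx eq_sym (negPf xy) (negPf yz).
    have sz : a2 = stack s1 z.
      by rewrite !stack_update /= eqxx !(eq_sym z) (negPf xz) (negPf yz).
    rewrite [f b :: a2](congr1 (cons (f b)) sz) /s1.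
    rewrite [b :: a1](congr1 (cons b) sy).
    by case: b {sy sz s1}; apply: run_seq (run_push _ _ _ _ (ltnSn 0))
      (run_push _ _ _ _ (ltnSn 0)) _.
  move=> u; rewrite !stack_update /=.
  case: (u =P z) => [->|_]; first by rewrite eq_sym (negPf xz).
  case: (u =P y) => [->|_]; first by rewrite eq_sym (negPf xy).
  by [].
- move=> u; rewrite !stack_update; case: (u =P x) => [->|] //.
  by case: (u =P z) => [->|] //; case: eqP => [->|].
Qed.

(** A move reverses a word, hence the detour through [t]: the second move restores [x] and delivers
    the image in the original order. *)
Definition copy_with (f : bool -> bool) (x y t : nat) : cmd :=
  Seq (move x t) (move_with f t x y).

Lemma run_copy_with o f x y z s t : x != y -> x != z -> y != z ->
  stack s z = [::] -> 9 * size (stack s x) + 1 < t ->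
  run o (copy_with f x y z) s (update s y (map f (stack s x) ++ stack s y)) t.
Proof.
move=> xy xz yz sz lt; set w := stack s x.
have lt1 : 4 * size w < (4 * size w).+1 by [].
pose s1 := update (update s z (catrev w (stack s z))) x [::].
have s1x : stack s1 x = [::] by rewrite stack_update eqxx.
have s1y : stack s1 y = stack s y.
  by rewrite !stack_update eq_sym (negPf xy) (negPf yz).
have s1z : stack s1 z = rev w.
  by rewrite !stack_update eq_sym (negPf xz) eqxx sz catrevE cats0.
have r1 : run o (move x z) s s1 (4 * size w).+1 by exact: run_move.
apply: (run_seq r1 (_ : run o _ s1 _ (t - (4 * size w).+1))); last first.
  by rewrite /w in lt *; lia.
have lt2 : 5 * size (stack s1 z) < t - (4 * size w).+1.
  by rewrite s1z size_rev /w; lia.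
rewrite eq_sym in xz; rewrite eq_sym in yz.
apply: run_to (run_move_with o f xz yz xy lt2) _.
rewrite s1x s1y s1z /s1 => u; rewrite !stack_update.
have [->|_] := eqVneq u z; first by rewrite (negPf yz) sz.
have [_|_] := eqVneq u y; first by rewrite map_rev catrevE revK.
by have [->|//] := eqVneq u x; rewrite catrevE revK cats0.
Qed.

Definition copy : nat -> nat -> nat -> cmd := copy_with id.
Definition zeros : nat -> nat -> nat -> cmd := copy_with (fun=> false).

Lemma run_clear o x s t : 3 * size (stack s x) < t ->
  run o (clear x) s (update s x [::]) t.
Proof.
move=> lt; apply: run_from (@run_each unit (fun _ _ => tt)
  (fun _ => update s x) o x Skip Skip 0 _ _ _ (stack s x) tt t lt) _.
- by move=> _ w; rewrite stack_update eqxx.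
- by move=> _ b w z; rewrite !stack_update; case: eqP.
- by move=> _ [] w; apply: run_skip.
- by move=> z; rewrite stack_update; case: eqP => [->|].
Qed.

Lemma run_seq_sum o c1 c2 s s1 s2 t1 t2 : run o c1 s s1 t1 ->
  run o c2 s1 s2 t2 -> run o (Seq c1 c2) s s2 (t1 + t2).
Proof. by move=> r1 r2; apply: run_seq r1 r2 _. Qed.

Lemma run_eq o c s s1 s' t t' : run o c s s1 t -> s1 = s' -> t <= t' ->
  run o c s s' t'.
Proof. by move=> r <-; apply: run_weak. Qed.

(** Executes loop-free code on a store given as an explicit list. The cost is an existential
    variable filled in by the rules; [run_eq] compares it with the claimed bound at the end. *)
Ltac symbolic :=
  cbn [stack update nth set_nth behead head];
  lazymatch goal with
  | |- run _ Skip _ _ _ => exact: (run_skip _ _ 0)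
  | |- run _ (Push _ _) _ _ _ => exact: (run_push _ _ _ _ (ltnSn 0))
  | |- run _ (Pop _) _ _ _ => exact: (run_pop _ _ _ (ltnSn 0))
  | |- run _ (Query _ _) _ _ _ => exact: (run_query _ _ _ _ (ltnSn 0))
  | |- run _ (Seq _ _) _ _ _ => eapply run_seq_sum; [symbolic | symbolic]
  | |- run _ (Case _ _ _ _) _ _ _ =>
      eapply run_case; [symbolic | exact: ltnSn]
  | |- run _ (copy_bit _ _) _ _ _ => eapply run_copy_bit; reflexivity
  | |- _ => idtac
  end.

(** * Set operations on characteristic vectors *)

(* 0: the unary number of elements; 1: the graph; 2: the decisions, latest on
   top; 3: one bit per undecided edge; 4: the unary matching number; 5: nonempty
   while the search goes on; 8: an edge set; 9: the matching found; 10, 11: unary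
   counters; 12: a vertex set; 14: a Boolean; 6, 7, 13: scratch; from 15 on: the
   stacks of the subroutine. *)
Definition st (N G W Z U R X RG A F C K Y RY B i0 i1 i2 i3 : word) : store :=
  [:: N; G; W; Z; U; R; X; RG; A; F; C; K; Y; RY; B; i0; i1; i2; i3].

(** Stack 12 has one bit per vertex, so emptying it measures out exactly one row of the incidence
    matrix. The bits read are saved on 7, from where the pass restores the graph. An edge without a
    decision on 8 counts as not taken. *)
Definition cover_bit : cmd :=
  Seq (Case 1 Skip
        (Seq (Pop 1) (Seq (Push 7 false) (copy_bit 12 13)))
        (Seq (Pop 1) (Seq (Push 7 true)
          (Case 8 (copy_bit 12 13) (copy_bit 12 13) (Push 13 true)))))
      (Pop 12).

Definition cover_row : cmd :=
  Seq (While 12 cover_bit) (Seq (move 13 12) (Pop 8)).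

Definition cover_pass : cmd := Seq (While 1 cover_row) (move 7 1).

Definition disjoint_bit : cmd :=
  Seq (Case 1 Skip
        (Seq (Pop 1) (Seq (Push 7 false) (copy_bit 12 13)))
        (Seq (Pop 1) (Seq (Push 7 true)
          (Case 12 Skip (Push 13 false) (Seq (Push 13 true) (Pop 14))))))
      (Pop 12).

(** Stack 8 serves only as a counter of decided edges. An edge is free if this counter is exhausted
    and no common vertex has emptied the flag on 14. *)
Definition disjoint_row : cmd :=
  Seq (Push 14 true) (Seq (While 12 disjoint_bit) (Seq (move 13 12)
    (Case 8 (Case 14 (Push 6 false) Skip (Seq (Pop 14) (Push 6 true)))
       (Seq (Pop 8) (Seq (Pop 14) (Push 6 false)))
       (Seq (Pop 8) (Seq (Pop 14) (Push 6 false)))))).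

Definition disjoint_pass : cmd := Seq (While 1 disjoint_row) (move 7 1).

Lemma run_cover_bits (o : oracle) (T : Type) (P Q : pred T) (xs : seq T)
    N G W Z U R X RG A F C K RY B i0 i1 i2 i3 t : 11 * size xs < t ->
  run o (While 12 cover_bit)
    (st N (map Q xs ++ G) W Z U R X RG A F C K (map P xs) RY B i0 i1 i2 i3)
    (st N G W Z U R X (catrev (map Q xs) RG) A F C K [::]
       (catrev (map (fun x => P x || (head false A && Q x)) xs) RY)
       B i0 i1 i2 i3) t.
Proof.
elim: xs RG RY t => [|x xs IHxs] RG RY t /= lt.
  by apply: run_stop => //; lia.
apply: (run_loop (t1 := 10)) (IHxs _ _ (t - 11) _) _ => //; try by lia.
rewrite /cover_bit /st.
by case: (Q x); case: (P x); case: A {IHxs} => [|[] A];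
  (eapply run_eq; [symbolic | reflexivity | ]).
Qed.

Lemma run_disjoint_bits (o : oracle) (T : Type) (P Q : pred T) (xs : seq T)
    N G W Z U R X RG A F C K RY (b : bool) i0 i1 i2 i3 t : 11 * size xs < t ->
  run o (While 12 disjoint_bit)
    (st N (map Q xs ++ G) W Z U R X RG A F C K (map P xs) RY (nseq b true)
       i0 i1 i2 i3)
    (st N G W Z U R X (catrev (map Q xs) RG) A F C K [::]
       (catrev (map P xs) RY)
       (nseq (b && ~~ has (fun x => P x && Q x) xs) true) i0 i1 i2 i3) t.
Proof.
elim: xs RG RY b t => [|x xs IHxs] RG RY b t /= lt.
  by rewrite andbT; apply: run_stop => //; lia.
rewrite negb_or andbA.
apply: (run_loop (t1 := 10)) (IHxs _ _ (b && ~~ (P x && Q x)) (t - 11) _) _ => //;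
  try by lia.
rewrite /disjoint_bit /st.
by case: (Q x); case: (P x); case: b {IHxs lt};
  (eapply run_eq; [symbolic | reflexivity | ]).
Qed.

Definition bits (T : finType) (xs : seq T) (S : {set T}) : word :=
  char_word xs (fun x => x \in S).

Definition rows (T : finType) (xs : seq T) (es : seq {set T}) : word :=
  flatten [seq bits xs e | e <- es].

Lemma size_bits (T : finType) (xs : seq T) S : size (bits xs S) = size xs.
Proof. exact: size_map. Qed.

Lemma size_rows (T : finType) (xs : seq T) es :
  size (rows xs es) = size es * size xs.
Proof.
by elim: es => //= e es IHes; rewrite /rows /= size_cat size_bits IHes mulSn.
Qed.

Fixpoint free_bits (T : finType) (S : {set T}) (k : nat) (es : seq {set T}) :
    word :=
  if es is e :: es' then ((k == 0) && [disjoint e & S]) :: free_bits S k.-1 es'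
  else [::].

(** Without vertices all rows would be empty and [While 1] would stop before reading the decisions
    on [A]; the first hypothesis excludes edges in that case. *)
Lemma run_cover_rows o (T : finType) (xs : seq T) (es : seq {set T})
    (S : {set T}) N W Z U R X RG A F C K B i0 i1 i2 i3 t :
  (0 < size xs) || (es == [::]) -> size es * (15 * size xs + 10) < t ->
  run o (While 1 cover_row)
    (st N (rows xs es) W Z U R X RG A F C K (bits xs S) [::] B i0 i1 i2 i3)
    (st N [::] W Z U R X (catrev (rows xs es) RG) (drop (size es) A) F C K
       (bits xs (S :|: \bigcup_(e <- mask A es) e)) [::] B i0 i1 i2 i3) t.
Proof.
elim: es S RG A t => [|e es IHes] S RG A t /= xs0 lt.
  by case: A => [|a A]; rewrite /= big_nil setU0; apply: run_stop => //; lia.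
rewrite orbF in xs0.
rewrite {2}/rows /= -/(rows xs es) catrev_catl.
have -> : drop (size es).+1 A = drop (size es) (behead A).
  by case: A => //=; rewrite drop_nil.
have -> : S :|: \bigcup_(e <- mask A (e :: es)) e =
  (if head false A then S :|: e else S) :|: \bigcup_(e <- mask (behead A) es) e.
  by case: A => [|[] A] //=; rewrite big_cons setUA.
rewrite mulSn in lt; set t1 := size es * _ in lt IHes.
set S' := if head false A then S :|: e else S.
apply: (run_loop (t1 := 15 * size xs + 8) (t2 := t1.+1)
  (s1 := st N (rows xs es) W Z U R X (catrev (bits xs e) RG) (behead A) F C K
           (bits xs S') [::] B i0 i1 i2 i3)); last by lia.
- by rewrite /stack /rows /=; case: (xs) xs0.
- rewrite /rows /= -/(rows xs es).
  apply: (run_seq (t1 := (11 * size xs).+1) (t2 := 4 * size xs + 2)).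
  + exact: run_cover_bits.
  + apply: (run_seq (t1 := (4 * size xs).+1) (t2 := 1)).
    * by apply: run_move; rewrite //= catrevE cats0 size_rev size_map.
    * apply: run_eq (run_pop _ _ _ (ltnSn 0)) _ (leqnn 1).
      rewrite /st /= !catrevE !cats0 revK.
      congr [:: _, _, _, _, _, _, _, _, _, _, _, _, _ & _].
      by apply: eq_map => x; rewrite /S'; case: ifP => _; rewrite ?inE ?orbF.
    * by lia.
  + by lia.
- by apply: IHes => //; rewrite xs0.
Qed.

Lemma run_cover o (T : finType) (xs : seq T) (es : seq {set T})
    (S : {set T}) N W Z U R X A F C K B i0 i1 i2 i3 t :
  (0 < size xs) || (es == [::]) ->
  size es * (19 * size xs + 10) + 2 <= t ->
  run o cover_pass
    (st N (rows xs es) W Z U R X [::] A F C K (bits xs S) [::] B i0 i1 i2 i3)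
    (st N (rows xs es) W Z U R X [::] (drop (size es) A) F C K
       (bits xs (S :|: \bigcup_(e <- mask A es) e)) [::] B i0 i1 i2 i3) t.
Proof.
move=> xs0 le; set t1 := size es * (15 * size xs + 10).
apply: (run_seq (t1 := t1.+1) (t2 := (4 * (size es * size xs)).+1)).
- by apply: run_cover_rows.
- apply: run_eq (run_move (t := (4 * (size es * size xs)).+1) _ _ _) _ _ => //.
    by rewrite /= catrevE cats0 size_rev size_rows.
  by rewrite /st /= !catrevE !cats0 revK.
- by rewrite /t1; nia.
Qed.

Lemma run_disjoint_rows o (T : finType) (xs : seq T) (es : seq {set T})
    (S : {set T}) N W Z U R X RG A F C K i0 i1 i2 i3 t :
  (forall x, x \in xs) ->
  (0 < size xs) || (es == [::]) -> size es * (15 * size xs + 10) < t ->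
  run o (While 1 disjoint_row)
    (st N (rows xs es) W Z U R X RG A F C K (bits xs S) [::] [::] i0 i1 i2 i3)
    (st N [::] W Z U R (catrev (free_bits S (size A) es) X)
       (catrev (rows xs es) RG) (drop (size es) A) F C K
       (bits xs S) [::] [::] i0 i1 i2 i3) t.
Proof.
move=> all_xs.
elim: es X RG A t => [|e es IHes] X RG A t /= xs0 lt.
  by case: A => [|a A]; apply: run_stop => //; lia.
rewrite orbF in xs0.
rewrite {2}/rows /= -/(rows xs es) catrev_catl.
have -> : drop (size es).+1 A = drop (size es) (behead A).
  by case: A => //=; rewrite drop_nil.
rewrite -size_behead; set b := _ && _.
rewrite mulSn in lt; set t1 := size es * _ in lt IHes.
apply: (run_loop (t1 := 15 * size xs + 8) (t2 := t1.+1)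
  (s1 := st N (rows xs es) W Z U R (b :: X) (catrev (bits xs e) RG) (behead A) F C K
           (bits xs S) [::] [::] i0 i1 i2 i3)); last by lia.
- by rewrite /stack /rows /=; case: (xs) xs0.
- rewrite /rows /= -/(rows xs es).
  apply: (run_seq (t1 := 1) (t2 := 15 * size xs + 7)); [exact: run_push | | by lia].
  apply: (run_seq (t1 := (11 * size xs).+1) (t2 := 4 * size xs + 6)).
  + exact: (@run_disjoint_bits _ _ _ _ _ _ _ _ _ _ _ _ _ _ _ _ _ _ true).
  + apply: (run_seq (t1 := (4 * size xs).+1) (t2 := 4)).
    * by apply: run_move; rewrite //= catrevE cats0 size_rev size_map.
    * rewrite /st /= !catrevE !cats0 revK.
      have -> : b = (size A == 0) &&
          ~~ has (fun x => (x \in S) && (x \in e)) xs.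
        congr (_ && _); apply/pred0P/hasPn => [H x _|H x] /=.
          by rewrite andbC; have /= -> := H x.
        by rewrite andbC; apply/negbTE/H.
      case: (has _ _) => /=; case: A {IHes lt t1 b} => [|[] A];
        by (eapply run_eq; [symbolic | reflexivity | ]).
    * by lia.
  + by lia.
- by apply: IHes => //; rewrite xs0.
Qed.

Lemma run_disjoint o (T : finType) (xs : seq T) (es : seq {set T})
    (S : {set T}) N W Z U R X A F C K i0 i1 i2 i3 t :
  (forall x, x \in xs) ->
  (0 < size xs) || (es == [::]) ->
  size es * (19 * size xs + 10) + 2 <= t ->
  run o disjoint_pass
    (st N (rows xs es) W Z U R X [::] A F C K (bits xs S) [::] [::] i0 i1 i2 i3)
    (st N (rows xs es) W Z U R (catrev (free_bits S (size A) es) X)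
       [::] (drop (size es) A) F C K
       (bits xs S) [::] [::] i0 i1 i2 i3) t.
Proof.
move=> all_xs xs0 le; set t1 := size es * (15 * size xs + 10).
apply: (run_seq (t1 := t1.+1) (t2 := (4 * (size es * size xs)).+1)).
- by apply: run_disjoint_rows.
- apply: run_eq (run_move (t := (4 * (size es * size xs)).+1) _ _ _) _ _ => //.
    by rewrite /= catrevE cats0 size_rev size_rows.
  by rewrite /st /= !catrevE !cats0 revK.
- by rewrite /t1; nia.
Qed.

(** Decisions lie with the latest on top, whereas a pass over the graph meets the first edge
    first. *)
Definition reverse_copy : cmd :=
  Seq (move 2 6) (Seq (move_with id 6 2 13) (move 13 8)).

(** Stacks 15 to 18 receive the input of the subroutine: the instance, V(A) and the free edges. *)
Definition prepare : cmd :=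
  Seq reverse_copy (Seq (zeros 0 12 6) (Seq cover_pass
    (Seq (copy 2 8 6) (Seq disjoint_pass (Seq (move 6 18)
      (Seq (move 12 13) (Seq (move 13 17)
        (Seq (copy 0 15 6) (copy 1 16 6))))))))).

(** Every edge of the union F puts two units on 10 and takes one off 11. Once each vertex of V(F)
    has taken one off 10, the counters show 2|F| - |V(F)| and the number of edges still missing,
    both truncated at zero. *)
Definition or_bit_true : cmd :=
  Seq (Push 6 true) (Seq (Push 10 true) (Seq (Push 10 true) (Pop 11))).

Definition or_pass : cmd :=
  each 15 (Seq (Case 8 (Push 6 false) (Push 6 false) or_bit_true) (Pop 8))
          (Seq or_bit_true (Pop 8)).

(* On entry stack 10 is empty iff 2|F| <= |V(F)|, that is iff the edges of F are
   disjoint, and stack 11 is empty iff F has the maximum cardinality. *)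
Definition verdict : cmd :=
  Seq (Case 10 Skip Skip (Seq (Pop 14) (Push 14 false)))
    (Seq (Case 11 Skip Skip (Seq (Pop 14) (Push 14 false)))
      (Seq (clear 10) (clear 11))).

Definition examine : cmd :=
  Seq reverse_copy (Seq (copy 4 11 6) (Seq or_pass (Seq (move_with id 6 9 8)
    (Seq (zeros 0 12 6) (Seq cover_pass
      (Seq (Query 12 14) (Seq (each 12 Skip (Pop 10)) verdict))))))).

(** The length is that of [f]: the decisions [a] may reach only a prefix of the edges, and missing
    ones default to [false]. *)
Fixpoint or_word (a f : word) : word :=
  if f is b :: f' then (head false a || b) :: or_word (behead a) f' else [::].

Lemma size_or_word a f : size (or_word a f) = size f.
Proof. by elim: f a => //= b f IHf a; rewrite IHf. Qed.

Lemma run_reverse_copy o N G W Z U R F C K Y B i0 i1 i2 i3 t :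
  13 * size W + 3 <= t ->
  run o reverse_copy
    (st N G W Z U R [::] [::] [::] F C K Y [::] B i0 i1 i2 i3)
    (st N G W Z U R [::] [::] (rev W) F C K Y [::] B i0 i1 i2 i3) t.
Proof.
move=> le.
have r1 : run o (move 2 6)
    (st N G W Z U R [::] [::] [::] F C K Y [::] B i0 i1 i2 i3)
    (st N G [::] Z U R (rev W) [::] [::] F C K Y [::] B i0 i1 i2 i3)
    (4 * size W).+1.
  by apply: run_eq (run_move _ _ (ltnSn _)) _ (leqnn _).
have r2 : run o (move_with id 6 2 13)
    (st N G [::] Z U R (rev W) [::] [::] F C K Y [::] B i0 i1 i2 i3)
    (st N G W Z U R [::] [::] [::] F C K Y W B i0 i1 i2 i3)
    (5 * size (rev W)).+1.
  apply: run_eq (run_move_with _ id _ _ _ (ltnSn _)) _ (leqnn _) => //.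
  by rewrite /st /= map_id catrevE cats0 revK.
have r3 : run o (move 13 8)
    (st N G W Z U R [::] [::] [::] F C K Y W B i0 i1 i2 i3)
    (st N G W Z U R [::] [::] (rev W) F C K Y [::] B i0 i1 i2 i3)
    (4 * size W).+1.
  by apply: run_eq (run_move _ _ (ltnSn _)) _ (leqnn _).
apply: run_weak (run_seq_sum r1 (run_seq_sum r2 r3)) _.
by rewrite size_rev; lia.
Qed.

Lemma run_prepare o (T : finType) (xs : seq T) (es : seq {set T})
    W Z U R t (N := nseq (size xs) true)
    (X := \bigcup_(e <- mask (rev W) es) e) :
  (forall x, x \in xs) -> (0 < size xs) || (es == [::]) ->
  size W <= size es ->
  100 * (size es * size xs + size es + size xs + 1) <= t ->
  run o prepare
    (st N (rows xs es) W Z U R [::] [::] [::] [::] [::] [::] [::] [::] [::]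
        [::] [::] [::] [::])
    (st N (rows xs es) W Z U R [::] [::] [::] [::] [::] [::] [::] [::] [::]
        N (rows xs es) (bits xs X) (free_bits X (size W) es)) t.
Proof.
move=> all_xs xs0 szW le; set G := rows xs es.
have r1 := @run_reverse_copy o N G W Z U R [::] [::] [::] [::] [::]
  [::] [::] [::] [::] _ (leqnn _).
have r2 : run o (zeros 0 12 6)
    (st N G W Z U R [::] [::] (rev W) [::] [::] [::] [::] [::] [::]
        [::] [::] [::] [::])
    (st N G W Z U R [::] [::] (rev W) [::] [::] [::] (bits xs set0) [::] [::]
        [::] [::] [::] [::]) (9 * size xs + 2).
  apply: run_eq (run_copy_with _ (fun=> false) _ _ _ _ (leqnn _)) _ _ => //.
    rewrite /st /= cats0 /bits /char_word /N.
    congr [:: _, _, _, _, _, _, _, _, _, _, _, _, _ & _].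
    by elim: (xs) => //= x s <-; rewrite inE.
  by rewrite /= size_nseq; lia.
have r3 := @run_cover o T xs es set0 N W Z U R [::] (rev W) [::] [::] [::] [::]
  [::] [::] [::] [::] _ xs0 (leqnn _).
rewrite set0U -/X drop_oversize ?size_rev // in r3.
have r4 : run o (copy 2 8 6)
    (st N G W Z U R [::] [::] [::] [::] [::] [::] (bits xs X) [::] [::]
        [::] [::] [::] [::])
    (st N G W Z U R [::] [::] W [::] [::] [::] (bits xs X) [::] [::]
        [::] [::] [::] [::]) (9 * size W + 2).
  apply: run_eq (run_copy_with _ id _ _ _ _ (leqnn _)) _ _ => //.
    by rewrite /st /= cats0 map_id.
  by rewrite /=; lia.
have r5 := @run_disjoint o T xs es X N W Z U R [::] W [::] [::] [::] [::]
  [::] [::] [::] _ all_xs xs0 (leqnn _).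
rewrite drop_oversize // in r5.
have szH : size (free_bits X (size W) es) = size es.
  by elim: (es) (size W) => //= e es' IH k; rewrite IH.
set H := free_bits _ _ _ in r5 szH *.
have r6 : run o (move 6 18)
    (st N G W Z U R (catrev H [::]) [::] [::] [::] [::] [::] (bits xs X) [::] [::]
        [::] [::] [::] [::])
    (st N G W Z U R [::] [::] [::] [::] [::] [::] (bits xs X) [::] [::]
        [::] [::] [::] H) (4 * size es).+1.
  apply: run_eq (run_move _ _ (ltnSn _)) _ _ => //.
    by rewrite /st /= !catrevE !cats0 revK.
  by rewrite /= catrevE cats0 size_rev szH.
have r7 : run o (move 12 13)
    (st N G W Z U R [::] [::] [::] [::] [::] [::] (bits xs X) [::] [::]
        [::] [::] [::] H)
    (st N G W Z U R [::] [::] [::] [::] [::] [::] [::] (rev (bits xs X)) [::]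
        [::] [::] [::] H) (4 * size xs).+1.
  by apply: run_eq (run_move _ _ (ltnSn _)) _ _; rewrite //= size_bits.
have r8 : run o (move 13 17)
    (st N G W Z U R [::] [::] [::] [::] [::] [::] [::] (rev (bits xs X)) [::]
        [::] [::] [::] H)
    (st N G W Z U R [::] [::] [::] [::] [::] [::] [::] [::] [::]
        [::] [::] (bits xs X) H) (4 * size xs).+1.
  apply: run_eq (run_move _ _ (ltnSn _)) _ _ => //.
    by rewrite /st /= !catrevE !cats0 revK.
  by rewrite /= size_rev size_bits.
have r9 : run o (copy 0 15 6)
    (st N G W Z U R [::] [::] [::] [::] [::] [::] [::] [::] [::]
        [::] [::] (bits xs X) H)
    (st N G W Z U R [::] [::] [::] [::] [::] [::] [::] [::] [::]
        N [::] (bits xs X) H) (9 * size xs + 2).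
  apply: run_eq (run_copy_with _ id _ _ _ _ (leqnn _)) _ _ => //.
    by rewrite /st /= cats0 map_id.
  by rewrite /= size_nseq; lia.
have r10 : run o (copy 1 16 6)
    (st N G W Z U R [::] [::] [::] [::] [::] [::] [::] [::] [::]
        N [::] (bits xs X) H)
    (st N G W Z U R [::] [::] [::] [::] [::] [::] [::] [::] [::]
        N G (bits xs X) H) (9 * (size es * size xs) + 2).
  apply: run_eq (run_copy_with _ id _ _ _ _ (leqnn _)) _ _ => //.
    by rewrite /st /= cats0 map_id.
  by rewrite /= size_rows; lia.
apply: run_weak (run_seq_sum r1 (run_seq_sum r2 (run_seq_sum r3 (run_seq_sum r4
  (run_seq_sum r5 (run_seq_sum r6 (run_seq_sum r7 (run_seq_sum r8
  (run_seq_sum r9 r10))))))))) _.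
nia.
Qed.

Lemma run_or_pass o f N G W Z U R X RG A F C K Y RY B i1 i2 i3 t
    (w := or_word A f) : 10 * size f < t ->
  run o or_pass
    (st N G W Z U R X RG A F C K Y RY B f i1 i2 i3)
    (st N G W Z U R (catrev w X) RG (drop (size f) A) F
       (nseq (2 * count id w) true ++ C) (drop (count id w) K) Y RY B
       [::] i1 i2 i3) t.
Proof.
move=> lt.
pose step (a : word * word * word * word) b :=
  let: (X, A, C, K) := a in let v := head false A || b in
  (v :: X, behead A, (if v then true :: true :: C else C),
   if v then behead K else K).
pose S (a : word * word * word * word) f :=
  let: (X, A, C, K) := a in st N G W Z U R X RG A F C K Y RY B f i1 i2 i3.
have nseq2 m v : nseq m true ++ [:: true, true & v] = nseq (2 + m) true ++ v.
  by elim: m => //= m ->.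
have foldE : foldl step (X, A, C, K) f =
    (catrev w X, drop (size f) A, nseq (2 * count id w) true ++ C,
     drop (count id w) K).
  rewrite /w; elim: (f) (A) X C K => [|b g IHg] A' X C K.
    by rewrite /= !drop0.
  rewrite [foldl _ _ _]/= IHg /=; set v := _ || b.
  case: A' @v => [|a A'] v /=; rewrite ?drop_nil.
    case: v => //=; congr (_, _, _, _).
      by rewrite nseq2 -mulnS.
    by case: K => //=; rewrite drop_nil.
  case: v => //=; congr (_, _, _, _).
    by rewrite nseq2 -mulnS.
  by case: K => //=; rewrite drop_nil.
have lt' : (6 + 3) * size f < t by lia.
have := @run_each _ step S o 15 _ _ 6 _ _ _ f (X, A, C, K) t lt'.
rewrite foldE; apply => {lt lt' foldE w X A C K f t}.
- by move=> [[[X A] C] K] f.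
- by move=> [[[X A] C] K] b f.
- move=> [[[X A] C] K] b f; rewrite /S /st /step /or_bit_true.
  by case: b; case: A => [|[] A] /=; (eapply run_eq; [symbolic | reflexivity | ]).
Qed.

Lemma run_drop_pass o w N G W Z U R X RG A F C K RY B i0 i1 i2 i3 t :
  4 * size w < t ->
  run o (each 12 Skip (Pop 10))
    (st N G W Z U R X RG A F C K w RY B i0 i1 i2 i3)
    (st N G W Z U R X RG A F (drop (count id w) C) K [::] RY B i0 i1 i2 i3) t.
Proof.
move=> lt; pose step (c : word) b := if b then behead c else c.
have -> : drop (count id w) C = foldl step C w.
  elim: w C {lt} => [|[] w IHw] C //=; rewrite ?drop0 // -IHw.
  by case: C => //=; rewrite drop_nil.
apply: (@run_each _ step (fun c w =>
  st N G W Z U R X RG A F c K w RY B i0 i1 i2 i3) o 12 _ _ 1 _ _ _ w C t) => //.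
by move=> c [] v; [apply: run_pop | apply: run_weak (run_skip _ _ 0) _].
Qed.

Lemma run_verdict o N G W Z U R X RG A F c k Y RY b i0 i1 i2 i3 t :
  3 * (c + k) + 10 < t ->
  run o verdict
    (st N G W Z U R X RG A F (nseq c true) (nseq k true) Y RY [:: b] i0 i1 i2 i3)
    (st N G W Z U R X RG A F [::] [::] Y RY [:: [&& b, c == 0 & k == 0]]
       i0 i1 i2 i3) t.
Proof.
move=> lt.
have r0 : run o (Seq (clear 10) (clear 11))
    (st N G W Z U R X RG A F (nseq c true) (nseq k true) Y RY
       [:: [&& b, c == 0 & k == 0]] i0 i1 i2 i3)
    (st N G W Z U R X RG A F [::] [::] Y RY [:: [&& b, c == 0 & k == 0]]
       i0 i1 i2 i3) ((3 * c).+1 + (3 * k).+1).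
  apply: (@run_seq_sum _ _ _ _ (st N G W Z U R X RG A F [::] (nseq k true) Y RY
       [:: [&& b, c == 0 & k == 0]] i0 i1 i2 i3));
    by apply: run_eq (run_clear _ (ltnSn _)) _ _; rewrite //= size_nseq.
apply: (run_seq (t1 := 4) (t2 := 4 + ((3 * c).+1 + (3 * k).+1))
  (s1 := st N G W Z U R X RG A F (nseq c true) (nseq k true) Y RY
       [:: b && (c == 0)] i0 i1 i2 i3)); last by lia.
  case: c {lt r0} => [|c]; rewrite /st /= ?andbT ?andbF;
    by (eapply run_eq; [symbolic | reflexivity | ]).
apply: (run_seq (t1 := 4) (s1 := st N G W Z U R X RG A F (nseq c true)
   (nseq k true) Y RY [:: [&& b, c == 0 & k == 0]] i0 i1 i2 i3)) r0 _ => //.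
by rewrite andbA; case: k {lt} => [|k]; rewrite /st /= ?andbT ?andbF;
  (eapply run_eq; [symbolic | reflexivity | ]).
Qed.

Lemma run_examine o (T : finType) (xs : seq T) (es : seq {set T})
    W Z R f nu t (N := nseq (size xs) true) (F := or_word (rev W) f)
    (S := \bigcup_(e <- mask F es) e)
    (b := [&& answer o (bits xs S), 2 * count id F <= count id (bits xs S)
          & nu <= count id F]) :
  (0 < size xs) || (es == [::]) ->
  size W <= size es -> size f = size es -> nu <= size es ->
  100 * (size es * size xs + size es + size xs + 1) <= t ->
  run o examine
    (st N (rows xs es) W Z (nseq nu true) R [::] [::] [::] [::] [::] [::]
        [::] [::] [::] f [::] [::] [::])
    (st N (rows xs es) W Z (nseq nu true) R [::] [::] [::] F [::] [::] [::]
        [::] [:: b] [::] [::] [::] [::]) t.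
Proof.
move=> xs0 szW szf lenu le; set G := rows xs es; set U := nseq nu true.
have szF : size F = size es by rewrite size_or_word.
have r1 := @run_reverse_copy o N G W Z U R [::] [::] [::] [::] [::]
  f [::] [::] [::] _ (leqnn _).
have r2 : run o (copy 4 11 6)
    (st N G W Z U R [::] [::] (rev W) [::] [::] [::] [::] [::] [::]
        f [::] [::] [::])
    (st N G W Z U R [::] [::] (rev W) [::] [::] U [::] [::] [::]
        f [::] [::] [::]) (9 * size es + 2).
  apply: run_eq (run_copy_with _ id _ _ _ _ (leqnn _)) _ _ => //.
    by rewrite /st /= cats0 map_id.
  by rewrite /= size_nseq; lia.
have r3 := @run_or_pass o f N G W Z U R [::] [::] (rev W) [::] [::] U [::] [::]
  [::] [::] [::] [::] _ (ltnSn _).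
rewrite -/F catrevE !cats0 drop_oversize ?size_rev ?szf // in r3.
(* On unary counters [drop] is truncated subtraction, so an empty counter expresses an
   inequality. *)
rewrite {2}/U drop_nseq in r3.
set c := 2 * count id F in r3 b *; set k := nu - count id F in r3.
have r4 : run o (move_with id 6 9 8)
    (st N G W Z U R (rev F) [::] [::] [::] (nseq c true) (nseq k true) [::]
        [::] [::] [::] [::] [::] [::])
    (st N G W Z U R [::] [::] F F (nseq c true) (nseq k true) [::]
        [::] [::] [::] [::] [::] [::]) (5 * size es).+1.
  apply: run_eq (run_move_with _ id _ _ _ (ltnSn _)) _ _ => //.
    by rewrite /st /= map_id !catrevE !cats0 revK.
  by rewrite /= size_rev szF.
have r5 : run o (zeros 0 12 6)
    (st N G W Z U R [::] [::] F F (nseq c true) (nseq k true) [::]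
        [::] [::] [::] [::] [::] [::])
    (st N G W Z U R [::] [::] F F (nseq c true) (nseq k true) (bits xs set0)
        [::] [::] [::] [::] [::] [::]) (9 * size xs + 2).
  apply: run_eq (run_copy_with _ (fun=> false) _ _ _ _ (leqnn _)) _ _ => //.
    rewrite /st /= cats0 /bits /char_word /N.
    congr [:: _, _, _, _, _, _, _, _, _, _, _, _, _ & _].
    by elim: (xs) => //= x s <-; rewrite inE.
  by rewrite /= size_nseq; lia.
have r6 := @run_cover o T xs es set0 N W Z U R [::] F F (nseq c true)
  (nseq k true) [::] [::] [::] [::] [::] _ xs0 (leqnn _).
rewrite set0U -/S drop_oversize ?szF // in r6.
set y := bits xs S in r6 b *.
have r7 : run o (Query 12 14)
    (st N G W Z U R [::] [::] [::] F (nseq c true) (nseq k true) y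
        [::] [::] [::] [::] [::] [::])
    (st N G W Z U R [::] [::] [::] F (nseq c true) (nseq k true) y
        [::] [:: answer o y] [::] [::] [::] [::]) 1 by exact: run_query.
have r8 := @run_drop_pass o y N G W Z U R [::] [::] [::] F (nseq c true)
  (nseq k true) [::] [:: answer o y] [::] [::] [::] [::] _ (ltnSn _).
rewrite drop_nseq in r8.
have r9 := @run_verdict o N G W Z U R [::] [::] [::] F (c - count id y) k
  [::] [::] (answer o y) [::] [::] [::] [::] _ (ltnSn _).
rewrite !subn_eq0 -/b in r9.
apply: run_weak (run_seq_sum r1 (run_seq_sum r2 (run_seq_sum r3 (run_seq_sum r4
  (run_seq_sum r5 (run_seq_sum r6 (run_seq_sum r7 (run_seq_sum r8 r9)))))))) _.
have leF : count id F <= size es by rewrite -szF count_size.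
have szy : size y = size xs by exact: size_bits.
rewrite ?szy ?szf ?size_rev; nia.
Qed.

(** * Extending a set of edges to a maximum matching *)

Lemma or_word_map (T : eqType) (P : pred T) (w : word) (es : seq T) : uniq es ->
  or_word w [seq P e | e <- es] = [seq (e \in mask w es) || P e | e <- es].
Proof.
elim: es w => //= e es IHes w /andP[e_es ues]; rewrite IHes //.
have memP v e' : e' \in es -> (e' \in mask v (e :: es)) = (e' \in mask (behead v) es).
  move=> e'_es; case: v => [|[] v] //=; rewrite ?mask0s // in_cons.
  by case: eqP => // ee'; rewrite -ee' e'_es in e_es.
congr cons; last by apply/eq_in_map => e' /memP ->.
case: w => [|[] w] /=; rewrite ?mask0s ?in_cons ?eqxx //.
have /negbTE-> // : e \notin mask w es by apply: contra e_es => /mem_mask.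
Qed.

Lemma mask_map_mem (T : eqType) (P : pred T) (es : seq T) :
  mask [seq P e | e <- es] es = filter P es.
Proof. by rewrite filter_mask. Qed.

Lemma free_bitsE (T : finType) (X : {set T}) k es : uniq es ->
  free_bits X k es = [seq (e \in drop k es) && [disjoint e & X] | e <- es].
Proof.
elim: es k => //= e es IHes k /andP[e_es ues]; rewrite IHes //.
congr cons.
  case: k => [|k] /=; first by rewrite in_cons eqxx.
  by have /negbTE-> // : e \notin drop k es by apply: contra e_es => /mem_drop.
apply/eq_in_map => e' e'_es; case: k => [|k] //=; rewrite drop0 in_cons e'_es.
by rewrite orbT.
Qed.

Lemma bigcup_seq_cover (T : finType) (s : seq {set T}) :
  \bigcup_(e <- s) e = cover [set e in s].
Proof.
by rewrite bigcup_seq; apply: eq_bigl => e; rewrite inE.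
Qed.

Lemma cover_setU (T : finType) (A B : {set {set T}}) :
  cover (A :|: B) = cover A :|: cover B.
Proof. by rewrite /cover bigcup_setU. Qed.

Lemma count_id_filter (T : finType) (xs : seq T) (S : {set T}) :
  uniq xs -> {subset S <= xs} -> count id [seq x \in S | x <- xs] = #|S|.
Proof.
move=> uxs sub; rewrite count_map -size_filter cardE.
apply/perm_size/uniq_perm => [||x]; [exact: filter_uniq | exact: enum_uniq |].
rewrite mem_filter mem_enum; apply/andP/idP => [[]|xS] //.
by split=> //; apply: sub.
Qed.

Lemma count_id_bits (T : finType) (xs : seq T) (S : {set T}) :
  uniq xs -> (forall x, x \in xs) -> count id (bits xs S) = #|S|.
Proof. by move=> uxs all_xs; apply: count_id_filter. Qed.

(** An independent [X] is the only base of the restriction to [X], so the existential quantifier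
    over bases disappears. *)
Lemma contraction_matching (T : finType) (M : setsys T) (X : {set T})
    (E F : {set {set T}}) : is_matroid M -> X \in indep M ->
  (F \in matchings (contraction M X) E) =
  [&& F \subset E, trivIset F, cover F \subset ground M :\: X
    & cover F :|: X \in indep M].
Proof.
case=> gr _ _ _ iX; rewrite !inE; congr [&& _, _, _ & _].
apply/existsP/idP => [[B /andP[/maxsetP[]]]|iFX].
  rewrite inE => /andP[_ BX] maxB.
  by rewrite -(maxB X) // inE iX subxx.
exists X; rewrite iFX andbT; apply/maxsetP; rewrite inE iX subxx.
split=> // B; rewrite inE => /andP[_ BX] XB.
by apply/eqP; rewrite eqEsubset BX.
Qed.

(** Since edges have two ends, disjointness of edges becomes an equality of cardinalities, which the
    program can test with a counter. *)
Lemma card_matching (T : finType) (E F : {set {set T}}) :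
  is_graph [set: T] E -> F \subset E ->
  #|cover F| <= 2 * #|F| ?= iff trivIset F.
Proof.
move=> gE /subsetP FE; have -> : 2 * #|F| = \sum_(e in F) #|e|.
  rewrite mulnC -sum_nat_const; apply: eq_bigr => e /FE/gE[_ ->] //.
exact: leq_card_cover.
Qed.

(** [A] is an arbitrary set of decided edges. If the tests succeed, they certify [F] directly, and
    [F] meets [D] in [A] because [F'] avoids [D]. Conversely, an extension [S] makes V(A)
    independent, and then [F'] is at least as large as what [S] adds to [A]. *)
Lemma maximum_extensible (T : finType) (M : setsys T)
    (E D A F' F0 : {set {set T}}) (F := A :|: F')
    (H := [set e in E :\: D | [disjoint e & cover A]]) :
  is_matroid M -> ground M = [set: T] -> is_graph [set: T] E ->
  D \subset E -> A \subset D ->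
  F' \in maximum_matchings (contraction M (cover A)) H ->
  F0 \in maximum_matchings M E ->
  reflect (exists2 S, S \in maximum_matchings M E & S :&: D = A)
    [&& cover F \in indep M, 2 * #|F| <= #|cover F| & #|F0| <= #|F|].
Proof.
move=> mM gM gE DE AD F'max F0max.
have HE : H \subset E :\: D by apply/subsetP => e; rewrite inE => /andP[].
have F'H : F' \subset H by move: F'max; rewrite !inE => /andP[/and3P[]].
have F'D : F' :&: D = set0.
  apply/setP => e; rewrite !inE; apply/negbTE/andP => -[eF' eD].
  by have := subsetP (subset_trans F'H HE) _ eF'; rewrite inE eD.
have FE : F \subset E.
  rewrite subUset (subset_trans AD DE) /=.
  exact: subset_trans (subset_trans F'H HE) (subsetDl _ _).
apply: (iffP and3P) => [[iF le2 leF]|[S]].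
  exists F; last by rewrite setIUl F'D setU0; apply/setIidPl.
  have tF : trivIset F.
    by rewrite -(geq_leqif (card_matching gE FE)).
  rewrite inE inE FE tF iF /=; apply/forall_inP => S Sm.
  apply: leq_trans leF; move: F0max; rewrite inE => /andP[_ /forall_inP].
  exact.
rewrite inE => /andP[]; rewrite inE => /and3P[SE tS iS] /forall_inP maxS SD.
have AS : A \subset S by rewrite -SD subsetIl.
have iA : cover A \in indep M.
  case: mM => _ _ her _; apply: her iS _.
  by rewrite -(setUidPr AS) cover_setU subsetUl.
have tA : trivIset A by apply: trivIsetS tS.
have mF' := F'max; rewrite inE contraction_matching // in mF'.
have /andP[/and4P[_ tF' F'A iF'A] /forall_inP F'gt] := mF'.
have disF : [disjoint cover A & cover F'].
  rewrite disjoint_sym disjoints_subset; apply: subset_trans F'A _.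
  by rewrite setDE subsetIr.
have tF : trivIset F by apply: trivIsetU.
(* The rest of [S] is itself a matching of the contraction within [H], so maximality of [F'] applies
   to it. *)
have leSA : #|S :\: A| <= #|F'|.
  apply: F'gt; rewrite contraction_matching //.
  have disSA e : e \in S :\: A -> [disjoint e & cover A].
    rewrite inE => /andP[eA eS]; rewrite disjoint_sym disjoints_subset.
    apply/bigcupsP => a aA; rewrite -disjoints_subset.
    have /trivIsetP tS' := tS; apply: tS' => //.
      exact: subsetP AS _ aA.
    by apply: contra eA => /eqP <-.
  apply/and4P; split.
  - apply/subsetP => e eSA; rewrite inE disSA // andbT.
    move: eSA; rewrite !inE => /andP[eA eS]; rewrite (subsetP SE) // andbT.
    by apply: contra eA => eD; rewrite -SD inE eS.
  - by apply: trivIsetS tS; apply: subsetDl.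
  - rewrite gM setTD; apply/bigcupsP => e eSA.
    by rewrite -disjoints_subset disSA.
  - by rewrite -cover_setU setUC -{1}(setIidPr AS) setID.
have cF : #|F| = #|A| + #|F'|.
  rewrite cardsU; suff -> : A :&: F' = set0 by rewrite cards0 subn0.
  apply/eqP; rewrite -subset0 -F'D setIC; apply: setIS AD.
split.
- by rewrite cover_setU setUC.
- by rewrite (geq_leqif (card_matching gE FE)).
- rewrite cF; apply: leq_trans (_ : #|S| <= _); last first.
    by rewrite -(cardsID A S) (setIidPr AS) leq_add2l.
  by apply: maxS; move: F0max; rewrite inE => /andP[].
Qed.

(** * Words encoding sets of vertices and edges *)

Section Encoding.

Variable I : instance.

Let xs := enum (elements I).
Let es := enum (edges I).

Lemma encode_instanceE :
  encode_instance I = [:: nseq (size xs) true; rows xs es].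
Proof. by rewrite /encode_instance /num_elements cardE. Qed.

Lemma decode_bits (S : {set elements I}) : decode_vertices I (bits xs S) = S.
Proof.
apply/setP => x; rewrite inE (nth_map x); last by rewrite -cardE ltn_ord.
by rewrite nth_enum_rank.
Qed.

Lemma vertices_or_no_edges : (0 < size xs) || (es == [::]).
Proof.
rewrite -cardE; case ees : es => [|e s]; rewrite ?orbT // orbF.
have /edgesP[_ e2] : e \in edges I by rewrite -mem_enum -/es ees mem_head.
by apply: leq_trans (max_card (mem e)); rewrite e2.
Qed.

(** Costs are first counted in vertices and edges; this turns them into polynomials in the number of
    vertices alone. *)
Lemma card_edges_le : size es <= size xs * size xs.
Proof.
rewrite -!cardE; apply: leq_trans (_ : 'C(#|elements I|, 2) <= _).
  rewrite -cardsT -cards_draws; apply/subset_leq_card/subsetP => e /edgesP.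
  by rewrite inE => -[-> ->].
rewrite bin2 -divn2; apply: leq_trans (leq_div _ _) _.
by rewrite leq_mul2l leq_pred orbT.
Qed.

Lemma encode_edges_inj (F F' : {set {set elements I}}) :
  F \subset edges I -> F' \subset edges I ->
  encode_edges F = encode_edges F' -> F = F'.
Proof.
move=> /subsetP FE /subsetP F'E /eq_in_map eFF'; apply/setP => e.
case eE: (e \in edges I); first by apply: eFF'; rewrite mem_enum.
by rewrite (contraFF (FE e) eE) (contraFF (F'E e) eE).
Qed.

Lemma size_encode_edges (F : {set {set elements I}}) :
  size (@encode_edges I F) = size es.
Proof. exact: size_map. Qed.

Lemma count_encode_edges (F : {set {set elements I}}) : F \subset edges I ->
  count id (@encode_edges I F) = #|F|.
Proof.
move=> /subsetP FE; apply: count_id_filter; first exact: enum_uniq.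
by move=> e /FE; rewrite mem_enum.
Qed.

Lemma bigcup_encode_edges (F : {set {set elements I}}) : F \subset edges I ->
  \bigcup_(e <- mask (@encode_edges I F) es) e = cover F.
Proof.
move=> /subsetP FE; rewrite mask_map_mem bigcup_seq_cover; congr cover.
apply/setP => e; rewrite inE mem_filter mem_enum.
by apply: andb_idr => /FE.
Qed.

Lemma encode_edges_setU (w : word) (F : {set {set elements I}}) :
  or_word w (@encode_edges I F) =
  encode_edges ([set e in mask w es] :|: F).
Proof.
rewrite or_word_map ?enum_uniq //.
by apply: eq_map => e; rewrite !inE.
Qed.

Lemma encode_mask (w : word) : size w <= size es ->
  @encode_edges I [set e in mask w es] = w ++ nseq (size es - size w) false.
Proof.
move=> le; rewrite -[X in encode_edges X]setU0 -encode_edges_setU.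
have -> : @encode_edges I set0 = nseq (size es) false.
  by rewrite /encode_edges -/es; elim: (es) => //= e s ->; rewrite inE.
elim: (size es) w le => [|k IHk] [|b w] //= le; rewrite ?orbF ?IHk //.
by rewrite subn0.
Qed.

Lemma free_bits_encode (X : {set elements I}) k :
  free_bits X k es =
  encode_edges [set e in edges I :\: [set e in take k es] | [disjoint e & X]].
Proof.
rewrite free_bitsE ?enum_uniq //; apply/eq_in_map => e e_es.
rewrite !inE -[e \in edges I]mem_enum -/es e_es andbT; congr (_ && _).
have := e_es; rewrite -{1}(cat_take_drop k es) mem_cat.
have := enum_uniq (edges I); rewrite -/es -{1}(cat_take_drop k es) cat_uniq.
case/and3P=> _ /hasPn dis _; case: (boolP (e \in take k es)) => //= et _.
by apply/negbTE/negP => /dis; rewrite /= et.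
Qed.

(** Translates between matchings that agree with the decisions made (the language of
    [maximum_extensible]) and words with a given prefix (the language of the search). *)
Lemma prefix_encode (w : word) (S : {set {set elements I}}) : size w <= size es ->
  (S :&: [set e in take (size w) es] == [set e in mask w es]) =
  (take (size w) (@encode_edges I S) == w).
Proof.
move=> le; have [A] : exists A, A = [set e in mask w es] by eexists.
have encA := encode_mask le; move=> AE; rewrite -AE in encA *.
have subA : A \subset [set e in take (size w) es].
  apply/subsetP => e; rewrite AE !inE -{1}(cat_take_drop (size w) es).
  rewrite -[X in mask X _]cats0 mask_cat; last by rewrite size_takel.
  by rewrite mask0s cats0 => /mem_mask.
rewrite -[RHS](_ : (take (size w) (@encode_edges I S) ==
  take (size w) (@encode_edges I A)) = _); last by rewrite encA take_size_cat.
rewrite -!map_take -/es; apply/eqP/eqP => [SA|/eq_in_map SA].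
  by apply/eq_in_map => e et; rewrite -SA !inE et andbT.
apply/setP => e; rewrite !inE; case et: (e \in take _ _).
  by rewrite andbT SA.
by rewrite andbF; apply/esym/negbTE/negP => /(subsetP subA); rewrite inE et.
Qed.

End Encoding.

(** * Testing one node of the search tree *)

(** In contrast to [run], time and space get independent bounds, as a call of the subroutine
    requires. *)
Definition steps (o : oracle) (c : cmd) (s s' : store) (t m : nat) : Prop :=
  exists tr s0, [/\ exec o c s tr s0, equiv s0 s', outputs tr = [::],
    time tr <= t & space tr <= m].

Lemma run_steps o c s s' t t' m : run o c s s' t ->
  t * (call_time o).+1 <= t' -> store_size s + t + call_space o <= m ->
  steps o c s s' t' m.
Proof.
case=> tr [s0 [e q ot lt [mt _]]] tt' mm; exists tr, s0; split=> //.
  exact: leq_trans tt'.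
exact: leq_trans mm.
Qed.

Lemma steps_weak o c s s' t m t' m' : steps o c s s' t m -> t <= t' ->
  m <= m' -> steps o c s s' t' m'.
Proof.
case=> tr [s0 [e q ot lt mt]] tt mm; exists tr, s0.
by split=> //; [exact: leq_trans tt | exact: leq_trans mm].
Qed.

Lemma steps_to o c s s1 s' t m : steps o c s s1 t m -> equiv s1 s' ->
  steps o c s s' t m.
Proof.
case=> tr [s0 [e q ot lt mt]] st; exists tr, s0; split=> //.
exact: equiv_trans st.
Qed.

Lemma steps_seq o c1 c2 s s1 s2 t1 t2 t m :
  steps o c1 s s1 t1 m -> steps o c2 s1 s2 t2 m -> t1 + t2 <= t ->
  steps o (Seq c1 c2) s s2 t m.
Proof.
case=> tr1 [s1' [e1 q1 o1 l1 m1]] [tr2 [s2' [e2 q2 o2 l2 m2]]] tt.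
have q1' : equiv s1 s1' by move=> x; rewrite q1.
have [s3 q3 e3] := exec_equiv e2 q1'.
exists (tr1 ++ tr2), s3; split.
- exact: ExecSeq e1 e3.
- by move=> x; rewrite -q3 q2.
- by rewrite outputs_cat o1 o2.
- by rewrite time_cat; lia.
- by rewrite space_cat geq_max m1.
Qed.

(* The garbage left by the subroutine is polynomial in n + Q and in n + Q^, but
   not in n alone, so the time for erasing it must not be charged as space. *)
Lemma clear_steps o x s :
  steps o (clear x) s (update s x [::]) (3 * size (stack s x)).+1 (store_size s).
Proof.
move sx: (stack s x) => w; elim: w s sx => [|b w IHw] s sx.
  exists [:: Step 1 (store_size s)], s; split; rewrite ?costE ?maxn0 //.
    exact: ExecWhileStop.
  by move=> z; rewrite stack_update; case: eqP => [->|].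
have szu := store_size_update s x w; rewrite sx /= in szu.
have := IHw (update s x w); rewrite stack_update eqxx => /(_ erefl).
case=> tr [s0 [e q ot lt mt]].
exists ([:: Step 1 (store_size s), Step 1 (store_size s), Step 1 (store_size s)
         & tr]), s0; split=> //.
- apply: (@ExecWhileLoop _ _ _ _ (update s x w) _
    [:: Step 1 (store_size s); Step 1 (store_size s)]); rewrite ?sx //.
  apply: (@ExecSeq _ _ _ _ s _ [:: Step 1 (store_size s)] [:: Step 1 (store_size s)]).
    by apply: ExecCase; rewrite sx; case: b {sx}; apply: ExecSkip.
  by have := ExecPop o x s; rewrite sx.
- by move=> z; rewrite q !stack_update; case: eqP.
- by rewrite !costE /=; lia.
- by rewrite !costE; lia.
Qed.

Fixpoint clear_range (x k : nat) : cmd :=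
  if k is k'.+1 then Seq (clear x) (clear_range x.+1 k') else Skip.

Lemma clear_range_steps o x k s : exists2 s',
  steps o (clear_range x k) s s' (k * (3 * store_size s).+1) (store_size s) &
  forall y, stack s' y = if x <= y < x + k then [::] else stack s y.
Proof.
elim: k x s => [|k IHk] x s.
  exists s; first by exists [::], s; split; rewrite ?costE //; apply: ExecSkip.
  by move=> y; rewrite addn0; case: ifP => //; lia.
have := store_size_update s x [::]; rewrite /= addn0 => szu.
have [s' [tr [s0 [e q ot lt mt]]] s'E] := IHk x.+1 (update s x [::]).
exists s'; last first.
  move=> y; rewrite s'E stack_update; case: eqP => [->|nyx].
    have -> : x <= x < x + k.+1 by lia.
    by case: ifP.
  by have -> : (x < y < x.+1 + k) = (x <= y < x + k.+1) by lia.
apply: (steps_seq (clear_steps o x s) (t2 := k * (3 * store_size s).+1)).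
  exists tr, s0; split=> //; last by lia.
  by apply: leq_trans lt _; rewrite leq_mul2l; lia.
by rewrite mulSn; lia.
Qed.

(** Stack 15 is stack 0 of the subroutine and holds its answer, so erasing starts at 16. Garbage can
    lie only on the stacks that [c] writes and on its four input stacks, whence [width c + 4]. *)
Definition probe (c : cmd) : cmd :=
  Seq prepare (Seq (embed 15 c) (Seq (clear_range 16 (width c + 4)) examine)).

Definition solves (c : cmd) (p q : {poly nat}) (I : instance) : Prop :=
  forall (X : {set elements I}) (H : {set {set elements I}}),
  H \subset induced (edges I) (ground (contraction (matroid I) X)) ->
  exists (tr : seq event) (s : store) (F : {set {set elements I}}),
    [/\ exec (independence_oracle I) c
          (encode_instance I ++ [:: encode_vertices X; encode_edges H]) tr s,
        F \in maximum_matchings (contraction (matroid I) X) H,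
        stack s 0 = encode_edges F,
        time tr <= horner p (num_elements I + oracle_time I)
      & space tr <= horner q (num_elements I + oracle_space I)].

(** The unit of cost: up to constant factors it bounds the store outside the subroutine and the
    number of instructions of one pass over the graph. The summand [1] absorbs additive
    constants. *)
Definition volume (I : instance) : nat :=
  let n := size (enum (elements I)) in let m := size (enum (edges I)) in
  m * n + m + n + 1.

(** [prepare] and [examine] account for [100] each. After the call the store has at most
    [20 * volume I + t] bits, and erasing a stack takes three steps per bit and a final test. *)
Definition probe_time (c : cmd) (p : {poly nat}) (I : instance) : nat :=
  let t := horner p (num_elements I + oracle_time I) in
  200 * volume I * (oracle_time I).+1 + t
  + (width c + 4) * (3 * (20 * volume I + t)).+1.

(** Outside the call, at most [10 * volume I] bits are present and at most [100 * volume I] are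
    added; adding the space of the subroutine covers the call as well. *)
Definition probe_space (q : {poly nat}) (I : instance) : nat :=
  120 * volume I + oracle_space I
  + horner q (num_elements I + oracle_space I).

(** Stacks 3, 4 and 5 are parameters so that one statement serves both the initial call, where they
    are empty, and every node of the search. *)
Lemma probe_steps c p q I W Z R nu (es := enum (edges I))
    (N := nseq (size (enum (elements I))) true)
    (G := rows (enum (elements I)) es)
    (A := [set e in mask (rev W) es]) (D := [set e in take (size W) es])
    (H := [set e in edges I :\: D | [disjoint e & cover A]]) :
  solves c p q I -> size W <= size es -> size Z <= size es -> size R <= 1 ->
  nu <= size es ->
  exists2 F', F' \in maximum_matchings (contraction (matroid I) (cover A)) H &
  forall F, F = A :|: F' ->
  steps (independence_oracle I) (probe c)
    (st N G W Z (nseq nu true) R [::] [::] [::] [::] [::] [::] [::] [::] [::]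
        [::] [::] [::] [::])
    (st N G W Z (nseq nu true) R [::] [::] [::] (encode_edges F) [::] [::] [::]
        [::] [:: [&& cover F \in indep (matroid I), 2 * #|F| <= #|cover F|
                   & nu <= #|F|]] [::] [::] [::] [::])
    (probe_time c p I) (probe_space q I).
Proof.
move=> solve szW szZ szR lenu; set o := independence_oracle I.
set xs := enum (elements I) in N G *; set U := nseq nu true.
have xs0 : (0 < size xs) || (es == [::]) by exact: vertices_or_no_edges.
have all_xs x : x \in xs by rewrite mem_enum.
have leB : 100 * (size es * size xs + size es + size xs + 1) <= 100 * volume I.
  by rewrite /volume.
have r1 := @run_prepare o _ xs es W Z U R _ all_xs xs0 szW leB.
rewrite free_bits_encode bigcup_seq_cover -/A -/D -/H -/N -/G in r1.
have HI : H \subset induced (edges I) (ground (contraction (matroid I) (cover A))).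
  apply/subsetP => e; rewrite /H /induced !inE /= ground_matroid setTD.
  by case/andP=> /andP[_ ->]; rewrite disjoints_subset.
have [tr [s [F' [exe F'max s0 let_ les]]]] := solve _ _ HI.
exists F' => // F FE.
(* The frame for [exec_embed]: the 15 private stacks, so that the input of the subroutine begins at
   stack 15. *)
set P := [:: N; G; W; Z; U; R; [::]; [::]; [::]; [::]; [::];
  [::]; [::]; [::]; [::]] : store.
set s1 := st _ _ _ _ _ _ _ _ _ _ _ _ _ _ _ _ _ _ _ in r1.
set s2 := st _ _ _ _ _ _ _ _ _ _ _ _ _ _ _ _ _ _ _ in r1.
have szP : store_size P <= 5 * volume I.
  rewrite /P /N /G /U /store_size /= !size_nseq size_rows /volume -/es -/xs.
  clear -szW szZ szR lenu; move: szW szZ szR lenu.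
  by move: (size es) (size xs) (size W) (size Z) (size R) => *; nia.
set sin := encode_instance I ++ _ in exe.
have s2E : s2 = P ++ sin by rewrite /sin encode_instanceE.
have [tr' [exe' o' lt' ls']] := exec_embed P exe.
have szs2 : store_size s2 <= 10 * volume I.
  rewrite /s2 /N /G /U /store_size /= !size_nseq !size_bits !size_rows.
  rewrite /volume -/es -/xs; clear -szW szZ szR lenu; move: szW szZ szR lenu.
  by move: (size es) (size xs) (size W) (size Z) (size R) => *; nia.
have szsin : store_size sin <= 10 * volume I.
  by move: szs2; rewrite s2E store_size_cat; lia.
(* [sst] bounds the garbage for the time of erasing, [ssm] for its space. *)
have [sst ssm] := exec_size exe.
have [s3 r3 s3E] := clear_range_steps o 16 (width c + 4) (P ++ s).
rewrite store_size_cat in r3.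
have s3q : equiv s3 (st N G W Z U R [::] [::] [::] [::] [::] [::] [::] [::] [::]
    (encode_edges F') [::] [::] [::]).
  (* Stacks up to 15 are the frame and the answer. Those above are either erased, or lie beyond both
     [width c] and the input and so have always been empty. *)
  move=> y; rewrite s3E; case: (ltnP 15 y) => [lt15|le15]; last first.
    by do 15 (case: y le15 => [|y] le15 //); case: y le15.
  have -> : stack (st N G W Z U R [::] [::] [::] [::] [::] [::] [::] [::] [::]
      (encode_edges F') [::] [::] [::]) y = [::].
    by do 19 (case: y lt15 => [//|y] lt15); rewrite /stack /= nth_default.
  rewrite andTb; case: (ltnP y) => [//|ge].
  have -> : stack (P ++ s) y = stack s (y - 15).
    by rewrite -[y in LHS](@subnKC 15) ?(stack_shift P) //; lia.
  rewrite (exec_width exe); last by lia.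
  by rewrite /sin encode_instanceE /stack nth_default //=; lia.
have r2 : steps o (embed 15 c) s2 (P ++ s)
    (horner p (num_elements I + oracle_time I)) (probe_space q I).
  rewrite s2E; exists tr', (P ++ s); split=> //; first exact: leq_trans let_.
  by apply: leq_trans ls' _; rewrite /probe_space; lia.
have FsubE : F \subset edges I.
  rewrite FE subUset; apply/andP; split; apply/subsetP => e.
    by rewrite inE => /mem_mask; rewrite mem_enum.
  move: F'max; rewrite !inE => /andP[/and3P[/subsetP FH _ _] _] /FH.
  by rewrite !inE => /andP[/andP[]].
have r4 := @run_examine o _ xs es W Z R (encode_edges F') nu _ xs0 szW
  (size_encode_edges _) lenu leB.
rewrite encode_edges_setU -/es -/A -FE bigcup_encode_edges // in r4.
rewrite count_encode_edges // count_id_bits ?enum_uniq // in r4.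
rewrite {2}/o /independence_oracle [answer _ _]/= decode_bits in r4.
have szs1 : store_size s1 <= 10 * volume I.
  rewrite /s1 /N /G /U /store_size /= !size_nseq !size_rows.
  rewrite /volume -/es -/xs; clear -szW szZ szR lenu; move: szW szZ szR lenu.
  by move: (size es) (size xs) (size W) (size Z) (size R) => *; nia.
have p1 : steps o prepare s1 s2 (100 * volume I * (oracle_time I).+1)
    (probe_space q I).
  by apply: run_steps r1 _ _ => //; rewrite /probe_space /=; lia.
have sz4 : store_size (st N G W Z U R [::] [::] [::] [::] [::] [::] [::] [::]
    [::] (encode_edges F') [::] [::] [::]) <= 10 * volume I.
  rewrite /N /G /U /store_size /= !size_nseq size_encode_edges !size_rows.
  rewrite /volume -/es -/xs; clear -szW szZ szR lenu; move: szW szZ szR lenu.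
  by move: (size es) (size xs) (size W) (size Z) (size R) => *; nia.
have p4 := run_steps (t' := 100 * volume I * (oracle_time I).+1)
  (m := probe_space q I) r4 (leqnn _) _.
have p3 := steps_to (steps_weak (t' := (width c + 4) * (3 * (20 * volume I +
  horner p (num_elements I + oracle_time I))).+1) (m' := probe_space q I) r3 _ _) s3q.
apply: (steps_seq p1 (steps_seq r2 (steps_seq (p3 _ _) (p4 _) (leqnn _)) (leqnn _)) _).
- move: let_; set h := horner p _ => let_.
  by rewrite leq_mul2l ltnS leq_mul2l; apply/orP; right; apply/orP; right; lia.
- by rewrite /probe_space; lia.
- move: sz4; rewrite /probe_space [call_space _]/= /N /G /U => sz4; lia.
- by rewrite /probe_time; lia.
Qed.

(** * The search *)

Definition emits (o : oracle) (c : cmd) (s s' : store) (w : word) (t m : nat) :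
    Prop :=
  exists tr1 tr2 s0, [/\ exec o c s (tr1 ++ Out w :: tr2) s0, equiv s0 s',
    outputs tr1 = [::] /\ outputs tr2 = [::], time tr1 + time tr2 <= t
    & space (tr1 ++ tr2) <= m].

Lemma emits_emit o x s m : store_size s <= m ->
  emits o (Emit x) s s (stack s x) (size (stack s x)).+1 m.
Proof.
move=> le; exists [:: Step (size (stack s x)).+1 (store_size s)], [::], s.
by split; rewrite ?costE //; [apply: ExecEmit | lia..].
Qed.

Lemma emits_weak o c s s' w t m t' : emits o c s s' w t m -> t <= t' ->
  emits o c s s' w t' m.
Proof.
case=> tr1 [tr2 [s0 [e q ot lt mt]]] tt; exists tr1, tr2, s0.
by split=> //; exact: leq_trans tt.
Qed.

Lemma emits_steps o c1 c2 s s1 s2 w t1 t2 m :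
  emits o c1 s s1 w t1 m -> steps o c2 s1 s2 t2 m ->
  emits o (Seq c1 c2) s s2 w (t1 + t2) m.
Proof.
case=> tr1 [tr2 [s1' [e1 q1 [o1 o2] l1 m1]]] [tr [s2' [e2 q2 o3 l2 m2]]].
have q1' : equiv s1 s1' by move=> x; rewrite q1.
have [s3 q3 e3] := exec_equiv e2 q1'.
exists tr1, (tr2 ++ tr), s3; split.
- by have := ExecSeq e1 e3; rewrite -catA.
- by move=> x; rewrite -q3 q2.
- by rewrite outputs_cat o2 o3.
- by rewrite time_cat; lia.
- by rewrite catA space_cat geq_max m1.
Qed.

Lemma steps_emits o c1 c2 s s1 s2 w t1 t2 m :
  steps o c1 s s1 t1 m -> emits o c2 s1 s2 w t2 m ->
  emits o (Seq c1 c2) s s2 w (t1 + t2) m.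
Proof.
case=> tr [s1' [e1 q1 o1 l1 m1]] [tr1 [tr2 [s2' [e2 q2 [o2 o3] l2 m2]]]].
have q1' : equiv s1 s1' by move=> x; rewrite q1.
have [s3 q3 e3] := exec_equiv e2 q1'.
exists (tr ++ tr1), tr2, s3; split.
- by have := ExecSeq e1 e3; rewrite catA.
- by move=> x; rewrite -q3 q2.
- by rewrite outputs_cat o1 o2.
- by rewrite time_cat; lia.
- by rewrite -catA space_cat geq_max m1.
Qed.

Lemma emits_case o x ce cf ct s s' w t m :
  emits o (match stack s x with
           | [::] => ce | false :: _ => cf | true :: _ => ct end) s s' w t m ->
  store_size s <= m -> emits o (Case x ce cf ct) s s' w t.+1 m.
Proof.
case=> tr1 [tr2 [s0 [e q [o1 o2] l1 m1]]] le.
exists (Step 1 (store_size s) :: tr1), tr2, s0; split=> //.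
- exact: ExecCase.
- by rewrite time_cons; lia.
- by rewrite /= space_cons geq_max le.
Qed.

(** Each decision undone gives one bit back to 3, so decided and undecided edges always add up to
    all edges. Running out of decisions empties 5 and thereby ends the search. *)
Definition advance : cmd :=
  Seq (Push 6 true) (While 6 (Case 2 (Seq (Pop 6) (Pop 5))
    (Seq (Pop 2) (Seq (Push 2 true) (Pop 6))) (Seq (Pop 2) (Push 3 false)))).

Definition descend : cmd := Seq (clear 9) (Seq (Pop 3) (Push 2 false)).

(** At a live node, an empty stack 3 signals a leaf. There the completion left on 9 by the probe is
    the solution itself, ready to be emitted. *)
Definition search_step (c : cmd) : cmd :=
  Seq (probe c) (Case 14 Skip (Seq (Pop 14) (Seq (clear 9) advance))
    (Seq (Pop 14) (Case 3 (Seq (Emit 9) (Seq (clear 9) advance))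
                     descend descend))).

Definition idle (N G W Z U R : word) : store :=
  st N G W Z U R [::] [::] [::] [::] [::] [::] [::] [::] [::]
    [::] [::] [::] [::].

(* The lexicographic successor of the decisions [rev W], flipping the last
   [false] and undoing the decisions after it. *)
Fixpoint next (N G W : word) (k : nat) (U : word) : store :=
  match W with
  | [::] => idle N G [::] (nseq k false) U [::]
  | false :: W' => idle N G (true :: W') (nseq k false) U [:: true]
  | true :: W' => next N G W' k.+1 U
  end.

Lemma run_advance o N G W k U t : 6 * size W + 8 <= t ->
  run o advance (idle N G W (nseq k false) U [:: true]) (next N G W k U) t.
Proof.
move=> le; rewrite /advance /idle /st.
apply: (run_seq (t1 := 1) (t2 := t.-1) (run_push _ _ _ _ (ltnSn 0))); last by lia.
rewrite [update _ _ _]/=.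
have {le} : 6 * size W + 7 <= t.-1 by lia.
elim: W k {t}(t.-1) => [|[] W IHW] k t /= le.
- apply: (run_loop (t1 := 4) (t2 := 1)); last 1 first; [lia | done | |].
    eapply run_eq; [symbolic | reflexivity | done].
  exact: run_stop.
- apply: (run_loop (t1 := 4)) (IHW k.+1 (t - 6) _) _ => //; try by lia.
  by eapply run_eq; [symbolic | reflexivity | ].
- apply: (run_loop (t1 := 4) (t2 := 1)); last 1 first; [lia | done | |].
    eapply run_eq; [symbolic | reflexivity | done].
  exact: run_stop.
Qed.

(** [delays] does not split over a concatenation, since a delay may straddle the border. Hence the
    delays closed by an output are kept apart from the time [lag] still running at the end, which is
    handed to the next trace. *)
Fixpoint gaps (t : nat) (tr : seq event) : seq nat :=
  match tr with
  | [::] => [::]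
  | Step u _ :: tr' => gaps (t + u) tr'
  | Out _ :: tr' => t :: gaps 0 tr'
  end.

Fixpoint lag (t : nat) (tr : seq event) : nat :=
  match tr with
  | [::] => t
  | Step u _ :: tr' => lag (t + u) tr'
  | Out _ :: tr' => lag 0 tr'
  end.

Lemma delaysE t tr : delays t tr = rcons (gaps t tr) (lag t tr).
Proof. by elim: tr t => [|[u m|w] tr IHtr] t //=; rewrite IHtr. Qed.

Lemma gaps_cat t tr1 tr2 :
  gaps t (tr1 ++ tr2) = gaps t tr1 ++ gaps (lag t tr1) tr2.
Proof. by elim: tr1 t => [|[u m|w] tr IHtr] t //=; rewrite IHtr. Qed.

Lemma lag_cat t tr1 tr2 : lag t (tr1 ++ tr2) = lag (lag t tr1) tr2.
Proof. by elim: tr1 t => [|[u m|w] tr IHtr] t //=; rewrite IHtr. Qed.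

Lemma silent t tr : outputs tr = [::] ->
  gaps t tr = [::] /\ lag t tr = t + time tr.
Proof.
elim: tr t => [|[u m|w] tr IHtr] t //=; first by rewrite time_nil addn0.
by move=> /(IHtr (t + u))[-> ->]; rewrite time_cons addnA.
Qed.

Definition viable (I : instance) (w : word) : bool :=
  [exists S in maximum_matchings (matroid I) (edges I),
     take (size w) (encode_edges S) == w].

Section Search.

Variables (c : cmd) (p q : {poly nat}) (I : instance).
Variable F0 : {set {set elements I}}.

Hypothesis solve : solves c p q I.
Hypothesis F0max : F0 \in maximum_matchings (matroid I) (edges I).

Let o := independence_oracle I.
Let es := enum (edges I).
Let N := nseq (size (enum (elements I))) true.
Let G := rows (enum (elements I)) es.
Let U := nseq #|F0| true.

Lemma card_F0 : #|F0| <= size es.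
Proof.
rewrite -cardE; apply: subset_leq_card.
by move: F0max; rewrite !inE => /andP[/and3P[]].
Qed.

(** Hence the verdict depends on the prefix alone, whichever maximum matching of the contraction the
    subroutine returns. *)
Lemma viable_extensible W F' (A := [set e in mask (rev W) es])
    (D := [set e in take (size W) es])
    (H := [set e in edges I :\: D | [disjoint e & cover A]])
    (F := A :|: F') :
  size W <= size es ->
  F' \in maximum_matchings (contraction (matroid I) (cover A)) H ->
  [&& cover F \in indep (matroid I), 2 * #|F| <= #|cover F| & #|F0| <= #|F|] =
  viable I (rev W).
Proof.
move=> szW F'max; rewrite -size_rev in szW.
have DE : D \subset edges I.
  by apply/subsetP => e; rewrite inE => /mem_take; rewrite mem_enum.
have AD : A \subset D.
  apply/subsetP => e; rewrite !inE -{1}(cat_take_drop (size W) es).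
  rewrite -[X in mask X _]cats0 mask_cat; last first.
    by rewrite size_rev size_takel // -size_rev.
  by rewrite mask0s cats0 => /mem_mask.
have P := maximum_extensible (matroidP I) (ground_matroid I) (@edgesP I) DE AD
  F'max F0max.
apply/P/exists_inP => -[S Smax SD]; exists S => //.
  by rewrite -prefix_encode // size_rev; apply/eqP.
by apply/eqP; move: SD; rewrite -prefix_encode // size_rev.
Qed.

(** With every edge decided, [H] is empty and leaves nothing to add to [A]. *)
Lemma full_encode W F' (A := [set e in mask (rev W) es])
    (D := [set e in take (size W) es])
    (H := [set e in edges I :\: D | [disjoint e & cover A]]) :
  size W = size es ->
  F' \in maximum_matchings (contraction (matroid I) (cover A)) H ->
  encode_edges (A :|: F') = rev W.
Proof.
move=> szW; rewrite !inE => /andP[/and3P[F'H _ _] _].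
have F'0 : F' = set0.
  apply/eqP; rewrite -subset0; apply: subset_trans F'H _; apply/subsetP => e.
  rewrite !inE szW take_size mem_enum.
  by case: (e \in edges I).
by rewrite F'0 setU0 encode_mask ?size_rev ?szW // subnn cats0.
Qed.

Let state W k := idle N G W (nseq k false) U [:: true].

Let step_time := probe_time c p I + 100 * volume I * (oracle_time I).+1.
Let step_space := probe_space q I.

Lemma size_idle W k : size W + k <= size es ->
  store_size (state W k) <= 10 * volume I.
Proof.
have := card_F0; move=> leF le.
rewrite /state /idle /store_size /= /N /G /U !size_nseq size_rows /volume -/es.
by move: leF le; move: (size es) (size (enum _)) (size W) => *; nia.
Qed.

Definition probed W k (F : {set {set elements I}}) b : store :=
  st N G W (nseq k false) U [:: true] [::] [::] [::] (encode_edges F)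
     [::] [::] [::] [::] [:: b] [::] [::] [::] [::].

Lemma probe_viable W k : size W + k = size es ->
  exists2 F : {set {set elements I}}, (k = 0 -> encode_edges F = rev W) &
  steps o (probe c) (state W k) (probed W k F (viable I (rev W)))
    (probe_time c p I) step_space.
Proof.
move=> szWk; have szW : size W <= size es by lia.
have szk : size (nseq k false) <= size es by rewrite size_nseq; lia.
have [F' F'max st] := probe_steps (R := [:: true]) solve szW szk (leqnn 1) card_F0.
exists ([set e in mask (rev W) es] :|: F').
  by move=> k0; apply: full_encode => //; lia.
have := st _ erefl; rewrite viable_extensible //.
Qed.

Lemma size_probed W k F b : size W + k = size es ->
  store_size (probed W k F b) <= 12 * volume I.
Proof.
have := card_F0; move=> leF le.
rewrite /probed /store_size /= /N /G /U !size_nseq size_rows size_encode_edges.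
rewrite /volume -/es.
by move: leF le; move: (size es) (size (enum _)) (size W) => *; nia.
Qed.

Lemma run_leave W k F b t : size W + k = size es -> 20 * volume I <= t ->
  run o (Seq (Pop 14) (Seq (clear 9) advance)) (probed W k F b)
    (next N G W k U) t.
Proof.
move=> szWk le.
have r1 : run o (Pop 14) (probed W k F b)
  (st N G W (nseq k false) U [:: true] [::] [::] [::] (encode_edges F)
     [::] [::] [::] [::] [::] [::] [::] [::] [::]) 1 by exact: run_pop.
have r2 : run o (clear 9)
  (st N G W (nseq k false) U [:: true] [::] [::] [::] (encode_edges F)
     [::] [::] [::] [::] [::] [::] [::] [::] [::]) (state W k)
  (3 * size es).+1.
  by apply: run_eq (run_clear _ (ltnSn _)) _ _; rewrite //= size_encode_edges.
apply: run_weak (run_seq_sum r1 (run_seq_sum r2 (run_advance _ _ _ _ _ (leqnn _)))) _.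
by apply: leq_trans le; rewrite /volume -/es; nia.
Qed.

Lemma step_dead W k : size W + k = size es -> ~~ viable I (rev W) ->
  steps o (search_step c) (state W k) (next N G W k U) step_time step_space.
Proof.
move=> szWk dead; have [F _ st1] := probe_viable szWk.
have sz := size_probed F (viable I (rev W)) szWk.
apply: (steps_seq st1 (t2 := 50 * volume I * (oracle_time I).+1)); last first.
  by rewrite /step_time leq_add2l !leq_mul2r !orbT.
rewrite (negPf dead) in sz *.
have r : run o (Case 14 Skip (Seq (Pop 14) (Seq (clear 9) advance))
    (Seq (Pop 14) (Case 3 (Seq (Emit 9) (Seq (clear 9) advance))
                     descend descend)))
  (probed W k F false) (next N G W k U) (50 * volume I).
  apply: (run_case (t := 20 * volume I)); first exact: run_leave.
  by rewrite /volume; lia.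
by apply: run_steps r _ _ => //; rewrite /step_space /probe_space [call_space _]/=; lia.
Qed.

Lemma step_down W k : size W + k.+1 = size es -> viable I (rev W) ->
  steps o (search_step c) (state W k.+1) (state (false :: W) k)
    step_time step_space.
Proof.
move=> szWk live; have [F _ st1] := probe_viable szWk.
have sz := size_probed F (viable I (rev W)) szWk.
apply: (steps_seq st1 (t2 := 50 * volume I * (oracle_time I).+1)); last first.
  by rewrite /step_time leq_add2l !leq_mul2r !orbT.
rewrite live in sz *.
have r2 : run o (clear 9)
  (st N G W (nseq k.+1 false) U [:: true] [::] [::] [::] (encode_edges F)
     [::] [::] [::] [::] [::] [::] [::] [::] [::]) (state W k.+1)
  (3 * size es).+1.
  by apply: run_eq (run_clear _ (ltnSn _)) _ _; rewrite //= size_encode_edges.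
have r3 : run o (Seq (Pop 3) (Push 2 false)) (state W k.+1) (state (false :: W) k) 2.
  by rewrite /state /idle /st /=; eapply run_eq; [symbolic | reflexivity | ].
have r : run o (Case 14 Skip (Seq (Pop 14) (Seq (clear 9) advance))
    (Seq (Pop 14) (Case 3 (Seq (Emit 9) (Seq (clear 9) advance))
                     descend descend)))
  (probed W k.+1 F true) (state (false :: W) k) (50 * volume I).
  apply: (run_case (t := 1 + ((3 * size es).+1 + 2).+1)).
    apply: (run_seq_sum (run_pop _ _ _ (ltnSn 0))).
    apply: (run_case (t := (3 * size es).+1 + 2)) => //.
    exact: run_seq_sum r2 r3.
  by rewrite /volume -/es; lia.
by apply: run_steps r _ _ => //; rewrite /step_space /probe_space [call_space _]/=; lia.
Qed.

Lemma step_full W : size W = size es -> viable I (rev W) ->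
  emits o (search_step c) (state W 0) (next N G W 0 U) (rev W)
    step_time step_space.
Proof.
move=> szW live; have szWk : size W + 0 = size es by rewrite addn0.
have [F /(_ erefl) FW st1] := probe_viable szWk.
have sz := size_probed F (viable I (rev W)) szWk.
rewrite live in sz st1.
have vs : 12 * volume I <= step_space by rewrite /step_space /probe_space; lia.
set s1 := st N G W [::] U [:: true] [::] [::] [::] (encode_edges F)
     [::] [::] [::] [::] [::] [::] [::] [::] [::].
have sz1 : store_size s1 <= 12 * volume I.
  by apply: leq_trans sz; rewrite /s1 /probed /store_size /= !leq_add2l.
have r2 : run o (clear 9) s1 (state W 0) (3 * size es).+1.
  by apply: run_eq (run_clear _ (ltnSn _)) _ _; rewrite //= size_encode_edges.
have r3 : run o (Seq (clear 9) advance) s1 (next N G W 0 U) (20 * volume I).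
  apply: run_weak (run_seq_sum r2 (run_advance _ _ _ _ _ (leqnn _))) _.
  by rewrite /volume -/es; nia.
have e1 : emits o (Emit 9) s1 s1 (rev W) (size es).+1 step_space.
  have := emits_emit o 9 (leq_trans sz1 vs).
  by rewrite [stack _ _]/= size_encode_edges FW.
have e2 : emits o (Seq (Emit 9) (Seq (clear 9) advance)) s1 (next N G W 0 U)
    (rev W) ((size es).+1 + 20 * volume I * (oracle_time I).+1) step_space.
  apply: emits_steps e1 (run_steps r3 _ _) => //.
  by rewrite /step_space /probe_space [call_space _]/=; lia.
set t2 := _ + _ in e2.
have e3 : emits o (Case 3 (Seq (Emit 9) (Seq (clear 9) advance)) descend descend)
    s1 (next N G W 0 U) (rev W) t2.+1 step_space.
  by apply: emits_case; [exact: e2 | exact: leq_trans vs].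
have st0 : steps o (Pop 14) (probed W 0 F true) s1 (oracle_time I).+1 step_space.
  have r1 : run o (Pop 14) (probed W 0 F true) s1 1 by exact: run_pop.
  apply: run_steps r1 _ _; first by rewrite mul1n.
  have v0 : 0 < volume I by rewrite /volume; lia.
  by rewrite /step_space /probe_space [call_space _]/=; lia.
have e4 : emits o (Case 14 Skip (Seq (Pop 14) (Seq (clear 9) advance))
    (Seq (Pop 14) (Case 3 (Seq (Emit 9) (Seq (clear 9) advance))
                     descend descend)))
    (probed W 0 F true) (next N G W 0 U) (rev W)
    ((oracle_time I).+1 + t2.+1).+1 step_space.
  by apply: emits_case; [exact: steps_emits st0 e3 | exact: leq_trans vs].
apply: emits_weak (steps_emits st1 e4) _; rewrite /step_time leq_add2l /t2.
apply: leq_trans (_ : (size es + 4 + 20 * volume I) * (oracle_time I).+1 <= _).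
  by nia.
by rewrite leq_mul2r; apply/orP; right; rewrite /volume -/es; lia.
Qed.

Let good (v : word) : bool :=
  v \in [seq encode_edges F | F <- enum (maximum_matchings (matroid I) (edges I))].

Lemma viableP w :
  reflect (exists2 v, good v & take (size w) v = w) (viable I w).
Proof.
apply: (iffP exists_inP) => [[S Smax /eqP Sw]|[v /mapP[S]]].
  by exists (encode_edges S) => //; apply: map_f; rewrite mem_enum.
by rewrite mem_enum => Smax -> Sw; exists S => //; apply/eqP.
Qed.

Lemma size_good v : good v -> size v = size es.
Proof. by case/mapP=> S _ ->; apply: size_encode_edges. Qed.

Lemma take_good v W : good v -> size W < size es ->
  (take (size W) v == rev W) =
  (take (size W).+1 v == rev (false :: W)) || (take (size W).+1 v == rev (true :: W)).
Proof.
move=> /size_good szv; rewrite -szv => ltW.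
rewrite (take_nth false ltW) !rev_cons !eqseq_rcons.
by case: (nth false v _); rewrite ?andbT ?andbF ?orbF.
Qed.

Lemma viable_branch W : size W < size es -> viable I (rev W) ->
  viable I (rev (false :: W)) || viable I (rev (true :: W)).
Proof.
move=> ltW /viableP[v gv]; rewrite size_rev => /eqP.
by rewrite take_good // => /orP[]/eqP vW; apply/orP; [left | right];
  apply/viableP; exists v; rewrite // size_rev.
Qed.

(** * Iterations between consecutive outputs *)

Let loop := While 5 (search_step c).
Let period := step_time.+1.

(** [exec] describes only terminated loops, so a segment of the search is not an execution. It is
    expressed by what it does to continuations: every terminating run of the loop from [s'],
    preceded by [tr], gives one from [s]. Such segments compose. *)
Definition traverses (s s' : store) (tr : seq event) : Prop :=
  forall tr' s1, exec o loop s' tr' s1 -> exists s2, exec o loop s (tr ++ tr') s2.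

Lemma loop_traverses s s1 s' tr : stack s 5 <> [::] ->
  exec o (search_step c) s tr s1 -> equiv s1 s' ->
  traverses s s' (Step 1 (store_size s) :: tr).
Proof.
move=> s5 e es1 tr' s2 e2.
have q' : equiv s' s1 by move=> x; rewrite es1.
have [s3 q3 e3] := exec_equiv e2 q'.
by exists s3; apply: ExecWhileLoop e e3.
Qed.

Lemma traverses_cat s s1 s2 tr1 tr2 :
  traverses s s1 tr1 -> traverses s1 s2 tr2 -> traverses s s2 (tr1 ++ tr2).
Proof.
by move=> T1 T2 tr' s3 /T2[s4 /T1[s5 e]]; exists s5; rewrite -catA.
Qed.

Lemma size_state W k : size W + k = size es ->
  store_size (state W k) <= step_space.
Proof.
move=> szWk; apply: leq_trans (size_idle (eq_leq szWk)) _.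
by rewrite /step_space /probe_space; lia.
Qed.

(* With [k] undecided edges, a live node reaches its first output within
   [2 * k + 1] iterations and returns within [k.+1] iterations after its last
   one; consecutive outputs below it are at most [3 * k + 2] iterations apart. *)
Definition explores (k : nat) (W : word) (tr : seq event) : Prop :=
  [/\ traverses (state W k) (next N G W k U) tr, space tr <= step_space,
      uniq (outputs tr) /\ forall v,
        (v \in outputs tr) = good v && (take (size W) v == rev W),
      forall D t, (3 * k + 2) * period <= D -> t + (2 * k + 1) * period <= D ->
        all (fun d => d <= D) (gaps t tr)
    & if viable I (rev W) then forall t, lag t tr <= k.+1 * period
      else forall t, lag t tr <= t + period /\ gaps t tr = [::]].

Lemma explore_dead k W : size W + k = size es -> ~~ viable I (rev W) ->
  exists tr, explores k W tr.
Proof.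
move=> szWk dead; have sz1 := size_state szWk.
have [tr [s0 [e q0 ot lt mt]]] := step_dead szWk dead.
have tr_t t := silent t ot.
exists (Step 1 (store_size (state W k)) :: tr); split.
- exact: loop_traverses e q0.
- by rewrite space_cons geq_max sz1.
- rewrite -(cat1s (Step _ _)) !outputs_cat ot; split=> // v.
  apply/esym/negbTE/andP => -[gv /eqP vW]; case/negP: dead.
  by apply/viableP; exists v; rewrite // size_rev.
- by move=> D t _ _ /=; rewrite (tr_t _).1.
- rewrite (negPf dead) => t /=.
  by rewrite (tr_t _).1 (tr_t _).2 /period; split=> //; lia.
Qed.

Lemma explore k W : size W + k = size es -> exists tr, explores k W tr.
Proof.
elim: k W => [|k IHk] W szWk; have sz1 := size_state szWk;
  have [live|dead] := boolP (viable I (rev W)); try exact: explore_dead.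
- have szW : size W = size es by rewrite -szWk addn0.
  have [tr1 [tr2 [s0 [e q0 [o1 o2] lt mt]]]] := step_full szW live.
  have t1 t := silent t o1; have t2 t := silent t o2.
  exists (Step 1 (store_size (state W 0)) :: tr1 ++ Out (rev W) :: tr2).
  rewrite /explores live; split.
  + exact: loop_traverses e q0.
  + by rewrite space_cons space_cat space_cons max0n -space_cat geq_max sz1.
  + have -> : outputs (Step 1 (store_size (state W 0)) :: tr1 ++ Out (rev W) :: tr2)
        = [:: rev W].
      by rewrite -(cat1s (Step _ _)) -(cat1s (Out _)) !outputs_cat o1 o2.
    (* The prefix has full length, so it extends only to itself, and viability makes it a
       solution. *)
    split=> // v; rewrite inE; apply/eqP/andP => [->|[gv]].
      have /viableP[v' gv'] := live; rewrite size_rev szW => v'W.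
      split; last by rewrite take_oversize // size_rev szW.
      by rewrite -v'W take_oversize // size_good.
    by rewrite take_oversize ?szW ?size_good // => /eqP.
  + move=> D t le1 le2; rewrite /= gaps_cat (t1 _).1 /= (t2 _).1 (t1 _).2 /=.
    by rewrite andbT; move: le2; rewrite /period; lia.
  + move=> t; rewrite /= lag_cat /= (t2 _).2 /period; lia.
- have [tr [s0 [e q0 ot lt mt]]] := step_down szWk live.
  have tr_t t := silent t ot.
  have sz0 : size (false :: W) + k = size es by rewrite -szWk addnS.
  have sz1' : size (true :: W) + k = size es by rewrite -szWk addnS.
  have [tr0 [T0 m0 [u0 o0] g0 l0]] := IHk _ sz0.
  have [tr1 [T1 m1 [u1 o1] g1 l1]] := IHk _ sz1'.
  have ltW : size W < size es by lia.
  exists ((Step 1 (store_size (state W k.+1)) :: tr) ++ tr0 ++ tr1).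
  rewrite /explores live; split.
  + apply: traverses_cat (loop_traverses _ e q0) _ => //.
    exact: traverses_cat T0 T1.
  + by rewrite !space_cat space_cons !geq_max sz1 mt m0 m1.
  + have -> : outputs ((Step 1 (store_size (state W k.+1)) :: tr) ++ tr0 ++ tr1)
        = outputs tr0 ++ outputs tr1.
      by rewrite -(cat1s (Step _ _)) !outputs_cat ot.
    split.
      rewrite cat_uniq u0 u1 andbT; apply/hasPn => v; rewrite o1 o0 => /andP[_].
      move=> /eqP vW; apply/negP => /andP[_ /eqP]; rewrite vW !rev_cons.
      by move=> /eqP; rewrite eqseq_rcons andbF.
    move=> v; rewrite mem_cat o0 o1 -andb_orr.
    by case: (boolP (good v)) => //= gv; rewrite (take_good gv ltW).
  + move=> D t le1 le2; rewrite gaps_cat /= (tr_t _).1 /= (tr_t _).2.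
    rewrite gaps_cat all_cat; apply/andP; split.
      by apply: g0; move: le1 le2; rewrite /period; nia.
    move: l0 l1 (viable_branch ltW live).
    (* The [true] child is entered at most [k.+1] periods after an output if the [false] child is
       live, and otherwise two iterations after the entry of the parent. Its own [2 * k + 1] then
       gives [3 * k + 2] or [2 * k.+1 + 1], within the bounds for [k.+1]. *)
    case: (viable I (rev (false :: W))) => /(_ (t + 1 + time tr)) l0.
      by move=> _ _; apply: g1; move: le1 le2 l0; nia.
    by move=> _ _; apply: g1; move: le1 le2 l0.1; rewrite /period; nia.
  + move=> t; rewrite lag_cat /= (tr_t _).2 lag_cat.
    move: l0 l1 (viable_branch ltW live).
    (* If the [true] child is dead, the [false] child is live, and the lag after its last output
       grows by the one iteration spent on the dead sibling. *)
    case: (viable I (rev (true :: W))) => l0 l1.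
      by move=> _; apply: leq_trans (l1 _) _; rewrite leq_mul2r leqnSn orbT.
    rewrite orbF => v0; rewrite v0 in l0.
    apply: leq_trans (l1 _).1 _; rewrite mulSn addnC leq_add2l; exact: l0.
Qed.

(** [t] stands for the time of the initialisation, which counts towards the first delay. *)
Lemma search : exists tr s',
  [/\ exec o loop (state [::] (size es)) tr s',
      perm_eq (outputs tr) [seq encode_edges F
        | F <- enum (maximum_matchings (matroid I) (edges I))],
      forall t, t <= period ->
        all (fun d => d <= (3 * size es + 3) * period) (delays t tr)
    & space tr <= step_space].
Proof.
have [tr [T mt [uo oE] g]] := explore (erefl : size [::] + size es = size es).
have -> : viable I (rev [::]).
  apply/viableP; exists (encode_edges F0); last by rewrite take0.
  by apply: map_f; rewrite mem_enum.
move=> l; set s1 := next N G [::] (size es) U in T.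
(* After the root has been traversed stack 5 is empty, so the failing loop test is the continuation
   that [traverses] asks for. *)
have [s2 e] := T _ _ (ExecWhileStop o (search_step c) (erefl : stack s1 5 = [::])).
exists (tr ++ [:: Step 1 (store_size s1)]), s2; split=> //.
- rewrite outputs_cat cats0; apply: uniq_perm => // [|v].
    rewrite map_inj_in_uniq ?enum_uniq // => F F'.
    rewrite !mem_enum !inE => /andP[/and3P[FE _ _] _] /andP[/and3P[F'E _ _] _].
    exact: encode_edges_inj.
  by rewrite oE take0 andbT.
- move=> t le; rewrite delaysE gaps_cat lag_cat cats0 all_rcons; apply/andP; split.
    have p0 : 0 < period by [].
    apply: leq_trans (_ : lag t tr + period <= _).
      by rewrite leq_add2l.
    by have := l t; nia.
  by apply: g; nia.
- rewrite space_cat geq_max mt space_cons space_nil maxn0 /=.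
  apply: leq_trans (size_state (W := [::]) (k := size es) erefl).
  by rewrite /s1 /state /idle /store_size /= !leq_add2l; lia.
Qed.

End Search.

(** * Polynomial bounds *)

(** The probe without decisions leaves a maximum matching on 9. Reading it off yields one undecided
    bit per edge on 3 and the matching number in unary on 4; the verdict is discarded. *)
Definition initialise (c : cmd) : cmd :=
  Seq (probe c) (Seq (Pop 14) (Seq
    (each 9 (Push 3 false) (Seq (Push 3 false) (Push 4 true))) (Push 5 true))).

Lemma initialise_steps c p q I (N := nseq (size (enum (elements I))) true)
    (G := rows (enum (elements I)) (enum (edges I))) : solves c p q I ->
  exists2 F, F \in maximum_matchings (matroid I) (edges I) &
  steps (independence_oracle I) (initialise c)
    (idle N G [::] [::] [::] [::])
    (idle N G [::] (nseq (size (enum (edges I))) false) (nseq #|F| true) [:: true])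
    (probe_time c p I + 100 * volume I * (oracle_time I).+1) (probe_space q I).
Proof.
move=> solve; set o := independence_oracle I.
have [F Fmax st1] := probe_steps (W := [::]) (Z := [::]) (R := [::]) (nu := 0)
  solve (leq0n _) (leq0n _) (leq0n _) (leq0n _).
have A0 (T : finType) : [set e : {set T} in [::]] = set0.
  by apply/setP => e; rewrite !inE.
rewrite /= mask0s take0 !A0 in Fmax st1.
have c0 : cover set0 = set0 :> {set elements I} by rewrite /cover big_set0.
have [_ i0 _ _] := matroidP I.
have E0 : [set e in edges I :\: set0 | [disjoint e & cover set0]] = edges I.
  apply/setP => e; rewrite !inE c0 /=; apply: andb_idr => _.
  by rewrite disjoint_sym -setI_eq0 set0I.
(* Contracting the empty set leaves the matchings unchanged, so the first answer is a maximum
   matching of the instance. *)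
have same E (S : {set {set elements I}}) :
    (S \in matchings (contraction (matroid I) set0) E) =
    (S \in matchings (matroid I) E).
  rewrite (contraction_matching _ _ (matroidP I) i0) ground_matroid.
  by rewrite setD0 subsetT setU0 inE.
have Fm : F \in maximum_matchings (matroid I) (edges I).
  move: Fmax; rewrite E0 c0 inE same [in X in _ -> X]inE => /andP[-> /forall_inP le].
  by apply/forall_inP => S SE; apply: le; rewrite same.
exists F => //; have {st1} := st1 _ erefl; rewrite set0U; set b := [&& _, _ & _].
move=> st1.
have FE : F \subset edges I by move: Fm; rewrite !inE => /andP[/and3P[]].
have leF : #|F| <= size (enum (edges I)) by rewrite -cardE subset_leq_card.
pose step (a : word * word) (b : bool) :=
  (false :: a.1, if b then true :: a.2 else a.2).
pose S (a : word * word) w := st N G [::] a.1 a.2 [::] [::] [::] [::] w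
  [::] [::] [::] [::] [::] [::] [::] [::] [::].
have foldE : foldl step ([::], [::]) (encode_edges F) =
    (nseq (size (enum (edges I))) false, nseq #|F| true).
  rewrite -(size_encode_edges F) -(count_encode_edges FE).
  elim/last_ind: (encode_edges F) => // w a IHw.
  rewrite -cats1 foldl_cat IHw size_cat count_cat /= addn1.
  by case: a => /=; rewrite ?addn1 ?addn0.
have r2 : run o (Pop 14)
  (st N G [::] [::] [::] [::] [::] [::] [::] (encode_edges F)
      [::] [::] [::] [::] [:: b] [::] [::] [::] [::])
  (S ([::], [::]) (encode_edges F)) 1 by exact: run_pop.
have r3 : run o (each 9 (Push 3 false) (Seq (Push 3 false) (Push 4 true)))
    (S ([::], [::]) (encode_edges F))
    (S (foldl step ([::], [::]) (encode_edges F)) [::])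
    (5 * size (enum (edges I))).+1.
  apply: (@run_each _ step S o 9 _ _ 2) => //.
    by move=> a [] w; rewrite /S /st /step; (eapply run_eq; [symbolic | reflexivity | ]).
  by rewrite size_encode_edges.
have r4 : run o (Push 5 true) (S (foldl step ([::], [::]) (encode_edges F)) [::])
  (idle N G [::] (nseq (size (enum (edges I))) false) (nseq #|F| true) [:: true]) 1.
  by rewrite foldE; exact: run_push.
have r := run_seq_sum r2 (run_seq_sum r3 r4).
apply: (steps_seq st1
  (run_steps (t' := 100 * volume I * (oracle_time I).+1) r _ _)) => //.
- by rewrite leq_mul2r; apply/orP; right; rewrite /volume; lia.
- rewrite /o [call_space _]/= /store_size /= /N /G !size_nseq size_rows.
  rewrite size_encode_edges /probe_space.
  have : 10 * volume I <= 120 * volume I by lia.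
  rewrite {1}/volume; move: (size (enum (edges I))) (size (enum (elements I))).
  by move: (volume I) (oracle_space I) (horner q _) => *; lia.
Qed.

(** The semiring operations on [nat] are convertible to [addn] and [muln]; these restatements bring
    evaluations into the form that [lia] understands. *)
Lemma horner_addn (p q : {poly nat}) x :
  horner (p + q)%R x = horner p x + horner q x.
Proof. exact: hornerD. Qed.

Lemma horner_muln (p q : {poly nat}) x :
  horner (p * q)%R x = horner p x * horner q x.
Proof. exact: hornerM. Qed.

Lemma horner_const (a : nat) x : horner a%:P%R x = a.
Proof. exact: hornerC. Qed.

Lemma horner_var (x : nat) : horner 'X%R x = x.
Proof. exact: hornerX. Qed.

Definition horner_natE := (horner_addn, horner_muln, horner_const, horner_var).

Definition volume_poly : {poly nat} := ('X * 'X * 'X + 'X * 'X + 'X + 1%:P)%R.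

Lemma volume_le I x : num_elements I <= x -> volume I <= horner volume_poly x.
Proof.
move=> le; rewrite /volume_poly !horner_natE /volume.
rewrite -[size (enum (elements I))]cardE; set m := size _; move: le.
rewrite /num_elements => le; have mx : m <= x * x.
  by apply: leq_trans (card_edges_le I) _; rewrite -cardE leq_mul.
by rewrite !leq_add // leq_mul.
Qed.

(** The first factor bounds the iterations per delay, [3 * m + 3] with m at most the square of n.
    The second bounds one iteration: [300] collects the [200] of [probe_time] and the [100] granted
    to the rest of a step. *)
Definition delay_poly (c : cmd) (p : {poly nat}) : {poly nat} :=
  ((3%:P * 'X * 'X + 3%:P) *
   (300%:P * volume_poly * ('X + 1%:P) + p
    + (width c + 4)%:P * (3%:P * (20%:P * volume_poly + p) + 1%:P) + 1%:P))%R.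

Lemma delay_polyE c p x : horner (delay_poly c p) x =
  (3 * x * x + 3) * (300 * horner volume_poly x * (x + 1) + horner p x
    + (width c + 4) * (3 * (20 * horner volume_poly x + horner p x) + 1) + 1).
Proof. by rewrite /delay_poly; move: volume_poly => v; rewrite !horner_natE. Qed.

Definition space_poly (q : {poly nat}) : {poly nat} :=
  (120%:P * volume_poly + 'X + q)%R.

Lemma space_polyE q x :
  horner (space_poly q) x = 120 * horner volume_poly x + x + horner q x.
Proof. by rewrite /space_poly; move: volume_poly => v; rewrite !horner_natE. Qed.

Lemma period_le K V Q P v x : V <= v -> Q <= x ->
  200 * V * Q.+1 + P + K * (3 * (20 * V + P)).+1 + 100 * V * Q.+1
  < 300 * v * (x + 1) + P + K * (3 * (20 * v + P) + 1) + 1.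
Proof.
move=> Vv Qx; have le1 : V * Q.+1 <= v * (x + 1).
  by apply: leq_mul => //; rewrite addn1 ltnS.
have le2 : K * (3 * (20 * V + P)).+1 <= K * (3 * (20 * v + P) + 1).
  by rewrite leq_mul2l; apply/orP; right; lia.
by rewrite -!mulnA; lia.
Qed.

Theorem theorem3 (C : instance -> Prop) :
  tractable C -> maximum_matchings_enumerable C.
Proof.
case=> _ _ [c [p [q solve]]].
exists (Seq (initialise c) (While 5 (search_step c))), (delay_poly c p), (space_poly q).
move=> I CI; have solveI : solves c p q I by exact: solve.
have [F Fmax [tr1 [s1 [e1 q1 o1 t1 m1]]]] := initialise_steps solveI.
have [tr2 [s2 [e2 pm dl m2]]] := search solveI Fmax.
(* The input has two stacks, the working store nineteen; they differ only by trailing empty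
   stacks. *)
have st0 : equiv (idle (nseq (size (enum (elements I))) true)
    (rows (enum (elements I)) (enum (edges I))) [::] [::] [::] [::])
    (encode_instance I).
  rewrite encode_instanceE; do 2 case=> [//|]; move=> y.
  rewrite [RHS]nth_default // /stack; do 17 (case: y => [//|y]).
  by rewrite nth_default.
have [s3 q3 e3] := exec_equiv e1 st0.
have q13 : equiv (idle (nseq (size (enum (elements I))) true)
    (rows (enum (elements I)) (enum (edges I))) [::]
    (nseq (size (enum (edges I))) false) (nseq #|F| true) [:: true]) s3.
  by move=> x; rewrite -q3 q1.
have [s4 q4 e4] := exec_equiv e2 q13.
exists (tr1 ++ tr2), s4; split.
- exact: ExecSeq e3 e4.
- by rewrite outputs_cat o1.
- have [g1 l1] := silent 0 o1.
  rewrite delaysE gaps_cat lag_cat g1 l1 -delaysE add0n.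
  (* The initialisation fits into one period, as [search] demands of the time already elapsed. *)
  apply: sub_all (dl _ _) => [d le|]; last exact: leqW.
  apply: leq_trans le _; rewrite delay_polyE.
  set x := num_elements I + oracle_time I.
  have vx : volume I <= horner volume_poly x by apply: volume_le; apply: leq_addr.
  have mx : size (enum (edges I)) <= x * x.
    apply: leq_trans (card_edges_le I) _; rewrite -cardE.
    by apply: leq_mul; apply: leq_addr.
  have Qx : oracle_time I <= x by apply: leq_addl.
  apply: leq_mul; first by lia.
  exact: period_le.
- rewrite space_cat geq_max space_polyE.
  set x := num_elements I + oracle_space I.
  have vx : volume I <= horner volume_poly x by apply: volume_le; apply: leq_addr.
  have le : probe_space q I <= 120 * horner volume_poly x + x + horner q x.
    by rewrite /probe_space -/x leq_add2r; apply: leq_add; [lia | apply: leq_addl].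
  by rewrite (leq_trans m1 le) (leq_trans m2 le).
Qed.
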